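(* Let $(P,\le)$ be a finite poset, let $G=\mathrm{inc}(P)$ be its incomparability graph, and let $\lambda$ be a partition of $|V(G)|$. Then \[ [s_{\lambda}]X_G=\sum_{T\in\tilde{\mathcal{T}}_{\lambda,G}}\mathrm{sgn}(T), \] where $\tilde{\mathcal{T}}_{\lambda,G}$ is the set of special rim hook $G$-tabloids $T$ of shape $\lambda$ (with respect to the partial order $\le$ of $P$) whose tail sequence $\mathrm{ts}(T)$ is a non-increasing sequence in $G$.
   Context: Incomparability graph: $\mathrm{inc}(P)$ has the elements of $P$ as vertices, with $x,y$ adjacent if and only if they are incomparable in $P$. Chromatic symmetric function: for a finite graph $G$ with vertices $v_1,\ldots,v_n$, $X_G=\sum_{\mathcal{C}}x_{\mathcal{C}(v_1)}\cdots x_{\mathcal{C}(v_n)}$, summed over all proper colorings $\mathcal{C}:V(G)\to\{1,2,3,\ldots\}$. $[s_\lambda]X_G$ is the coefficient of the Schur function $s_\lambda$ in the Schur basis expansion of $X_G$. Diagrams and rim hooks: the diagram of a partition $\lambda=(\lambda_1,\ldots,\lambda_k)$ is the left-justified array of cells with $\lambda_i$ cells in row $i$, rows indexed from top to bottom. A rim hook of length $m$ of a diagram is a sequence of $m$ connected cells, each lying on the southeast boundary of the diagram, whose removal leaves a smaller diagram (of a partition). Reading a rim hook from its southwest end to its northeast end, each passage between consecutive cells is a step: a north step if the cells are in different rows, an east step if they are in different columns. Special rim hook tabloids: a rim hook tabloid of shape $\lambda$ is a filling (tiling) of the diagram of $\lambda$ by sequences of connected cells $r_1,\ldots,r_j$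 such that $r_1$ is a rim hook of $\lambda$ and, for each $1\le i\le j-1$, $r_{i+1}$ is a rim hook of the diagram obtained from $\lambda$ by removing $r_1,\ldots,r_i$. It is a special rim hook (SRH) tabloid if every rim hook $r_i$ intersects the first column. Its sign is $\mathrm{sgn}(T)=(-1)^{\#\text{ north steps in }T}$, the total number of north steps over all its rim hooks. SRH $G$-tabloids: for $G=\mathrm{inc}(P)$ with the partial order $\le$ of $P$, an SRH $G$-tabloid of shape $\lambda$ is an SRH tabloid of shape $\lambda$ in which the cells are filled with the vertices of $G$, each vertex used exactly once, such that for each rim hook (i) the vertices in its cells form a stable set of $G$ (pairwise non-adjacent), and (ii) reading these vertices from southwest to northeast gives an increasing sequence with respect to $\le$. Its sign is that of the underlying SRH tabloid. Tail sequence: $\mathrm{ts}(T)$ is the sequence of vertices of $G$ lying in the rows of length $1$ of $T$, read from bottom to top. Non-increasing sequence: a sequence $(v_1,\ldots,v_m)$ of vertices of $G$ such that $v_i\nleq v_{i+1}$ for $1\le i\le m-1$ (the empty sequence and one-term sequences qualify). *)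

(* Defs.v *)
From HB Require Import structures.
From mathcomp Require Import all_boot all_order all_algebra finmap multiset.
(* Not imported: their notations for sets would hide those of finset. *)
From mathcomp Require classical_sets cardinality.

Set Implicit Arguments.
Unset Strict Implicit.
Unset Printing Implicit Defensive.

Import Order.TTheory GRing.Theory Num.Theory.
Local Open Scope ring_scope.

Definition is_part (s : seq nat) : bool := sorted geq s && (0%N \notin s).

Record intpart := IntPart { parts :> seq nat; _ : is_part parts }.
HB.instance Definition _ := [isSub for parts].
HB.instance Definition _ := [Choice of intpart by <:].

(* The cells of the diagram of [la]: row [tag c] (from top to bottom), column
   [tagged c], both counted from 0. *)
Definition cell (la : seq nat) := {i : 'I_(size la) & 'I_(nth 0%N la i)}.
Definition crow la (c : cell la) : nat := tag c.
Definition ccol la (c : cell la) : nat := tagged c.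

(** * Symmetric functions *)

(* Monomials in x_1, x_2, ... are finite multisets of indices, the variable
   x_(i+1) being indexed by [i : nat]; a formal power series is the function
   giving the coefficient of each monomial. *)
Definition series := {mset nat}%mset -> int.

(* The sum over [i] in [A] of the monomials [w i]. When a monomial is reached
   infinitely often the sum is not a power series and [fset_set] returns the
   empty set; this occurs neither for colorings nor for tableaux. *)
Definition mono_sum (I : choiceType) (A : classical_sets.set I)
    (w : I -> {mset nat}%mset) : series :=
  fun m => #|` cardinality.fset_set (fun i => A i /\ w i = m)|%fset%:Z.

(* For [f : {ffun D -> nat}], the monomial with one factor of index [f a] for
   each [a : D]. *)
Definition monomial (D : finType) (f : {ffun D -> nat}) : {mset nat}%mset :=
  seq_mset [seq f a | a <- enum D].

Definition proper_coloring (V : finType) (e : rel V) (C : {ffun V -> nat}) :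
  Prop := forall u v, e u v -> C u <> C v.

Definition chromatic_sf (V : finType) (e : rel V) : series :=
  mono_sum (fun C : {ffun V -> nat} => proper_coloring e C) (@monomial V).

Definition semistandard la (T : {ffun cell la -> nat}) : Prop :=
  (forall a b, crow a = crow b -> (ccol a <= ccol b)%N -> (T a <= T b)%N) /\
  (forall a b, ccol a = ccol b -> (crow a < crow b)%N -> (T a < T b)%N).

Definition schur (la : seq nat) : series :=
  mono_sum (fun T : {ffun cell la -> nat} => semistandard T)
           (@monomial (cell la)).

Definition schur_expansion (f : series) (c : {fsfun intpart -> int with 0}) :
  Prop := forall m, f m = \sum_(mu <- finsupp c) c mu * schur mu m.

(* [s_la] f. Schur functions are linearly independent, so the expansion is
   unique; the value is 0 if [f] has no expansion. *)
Definition schur_coef (f : series) (la : intpart) : int :=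
  (classical_sets.xget [fsfun] (fun c => schur_expansion f c)) la.

(** * Special rim hook tabloids *)

Section Tabloids.
Variable la : seq nat.
Implicit Types (D r : {set cell la}) (t : {set {set cell la}}).

Definition row_len D (i : 'I_(size la)) : nat := #|[set c in D | tag c == i]|.

Definition is_diagram D : bool :=
  [forall c, (c \in D) == (ccol c < row_len D (tag c))%N] &&
  [forall i : 'I_(size la), forall j : 'I_(size la),
     (i <= j)%N ==> (row_len D j <= row_len D i)%N].

Definition adjacent (a b : cell la) : bool :=
  (crow a == crow b) && ((ccol b == (ccol a).+1) || (ccol a == (ccol b).+1)) ||
  (ccol a == ccol b) && ((crow b == (crow a).+1) || (crow a == (crow b).+1)).

Definition connected_cells r : bool :=
  [forall a in r, forall b in r,
     connect [rel x y | [&& x \in r, y \in r & adjacent x y]] a b].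

(* A cell is on the southeast boundary when the cell diagonally below and to
   the right of it is missing. *)
Definition se_boundary D (c : cell la) : bool :=
  (c \in D) &&
  ~~ [exists c' in D, (crow c' == (crow c).+1) && (ccol c' == (ccol c).+1)].

Definition is_rim_hook D r : bool :=
  [&& r != set0, connected_cells r, [forall c in r, se_boundary D c]
    & is_diagram (D :\: r)].

Fixpoint strips_off D (s : seq {set cell la}) : bool :=
  if s is r :: s' then is_rim_hook D r && strips_off (D :\: r) s'
  else D == set0.

Definition is_rh_tabloid t : bool :=
  has (strips_off [set: cell la]) (permutations (enum t)).

Definition is_srh_tabloid t : bool :=
  is_rh_tabloid t && [forall r in t, exists c in r, ccol c == 0%N].

(* From bottom row to top row, and from left to right in each row; on a rim
   hook this goes from the southwest end to the northeast end. *)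
Definition sw_ne (a b : cell la) : bool :=
  (crow b < crow a)%N || (crow a == crow b) && (ccol a <= ccol b)%N.

Definition reading r : seq (cell la) := sort sw_ne (enum r).

Definition north_steps r : nat :=
  count (fun ab : cell la * cell la => crow ab.1 != crow ab.2)
        (zip (reading r) (behead (reading r))).

Definition tabloid_sign t : int := (-1) ^+ (\sum_(r in t) north_steps r)%N.

End Tabloids.

(** * Special rim hook G-tabloids, for G = inc(P) *)

Section GTabloids.
Variables (d : Order.disp_t) (P : finPOrderType d).

Definition inc : rel P := [rel x y | (x >< y)%O].

Definition non_increasing (s : seq P) : bool :=
  sorted (fun u v => ~~ (u <= v)%O) s.

Variable la : seq nat.

(* A tiling of the diagram by rim hooks, and the filling of the cells. *)
Definition g_tabloid := ({set {set cell la}} * {ffun cell la -> P})%type.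

Definition is_srh_g_tabloid (T : g_tabloid) : bool :=
  [&& is_srh_tabloid T.1,
      [forall v : P, #|[set c | T.2 c == v]| == 1%N],
      [forall r in T.1, forall a in r, forall b in r, ~~ inc (T.2 a) (T.2 b)]
    & [forall r in T.1,
         sorted (fun u v => u < v)%O [seq T.2 c | c <- reading r]]].

Definition tail_sequence (T : g_tabloid) : seq P :=
  [seq T.2 c | c <- reading [set c : cell la | nth 0%N la (crow c) == 1%N]].

Definition tail_g_tabloids : {set g_tabloid} :=
  [set T | is_srh_g_tabloid T && non_increasing (tail_sequence T)].

Definition g_tabloid_sign (T : g_tabloid) : int := tabloid_sign T.1.

End GTabloids.

(* Main.v *)
(** Let [h_m] be the generating series, in commuting variables indexed by [P],
    of the chains of size [m] of [P]. The coefficient of [X_G] at a monomial [x^a]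
    is the coefficient of the product of all variables in [\prod_k h_(a_k)],
    and the Pieri rule for Jacobi-Trudi determinants (valid in any commutative
    ring) gives [\prod_k h_(a_k) = \sum_la K_(la,a) det (h_(la_i - i + j))]. As
    [K_(la,a)] is the coefficient of [s_la] at [x^a], [[s_la] X_G] is the
    coefficient of the product of all variables in [det (h_(la_i - i + j))].
    Expanding this determinant along its last column removes the special rim hook
    through the last row, ending in an arbitrary row: the determinant is the
    signed sum, over all special rim hook tilings, of the products of the [h_m],
    and each such product counts the admissible fillings. Finally, for a fixed
    filling with an ascent in the tail, merging and splitting the rim hooks at
    that ascent cancels all tilings. *)
Require Import Defs.
From mathcomp Require Import all_boot all_order all_fingroup all_algebra.
From mathcomp Require Import zify finmap multiset mpoly.
From mathcomp Require boolp classical_sets cardinality.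

Set Implicit Arguments.
Unset Strict Implicit.
Unset Printing Implicit Defensive.

Import Order.TTheory GRing.Theory Num.Theory.
Local Open Scope ring_scope.

(** * Jacobi-Trudi determinants *)

(** The tail sequence depends on the filling and not on the tiling. That cancellation is proved by
    induction on the number of rows, through the recursion that removes the hook of the last row.

    All sums over partitions must be finite, so partitions appear as functions from ['I_n] to
    ['I_B]. The bound [B] exceeds [M + n], where [h m = 0] for [m > M]: determinant entries of such
    large index vanish, and the telescoping sums behind the Pieri rule close. For chains, [M] is the
    number of elements of [P]. *)

Lemma signr_addB (R : pzRingType) m n :
  (m <= n)%N -> (-1) ^+ (m + n) = (-1) ^+ (n - m) :> R.
Proof.
move=> le_mn; rewrite -{1}(subnKC le_mn) addnA addnn exprD.
by rewrite -[_ ^+ m.*2]signr_odd odd_double mul1r.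
Qed.

(** Index sets of sums are finite types, while shapes elsewhere are functions on [nat]; a missing
    part counts as 0. *)
Definition extend0 n B (f : {ffun 'I_n -> 'I_B}) (i : nat) : nat :=
  if insub i is Some j then f j else 0%N.

Lemma extend0_ord n B (f : {ffun 'I_n -> 'I_B}) (i : 'I_n) : extend0 f i = f i.
Proof. by rewrite /extend0 valK. Qed.

Lemma extend0_ge n B (f : {ffun 'I_n -> 'I_B}) i : (n <= i)%N -> extend0 f i = 0%N.
Proof. by move=> le_ni; rewrite /extend0 insubF // ltnNge le_ni. Qed.

Lemma extend0_lt n B (f : {ffun 'I_n -> 'I_B}) i : (0 < B)%N -> (extend0 f i < B)%N.
Proof. by rewrite /extend0; case: insub. Qed.

Section JacobiTrudi.
Variables (A : comNzRingType) (h : nat -> A).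

(** This is [h] at [a - b] with the convention that [h] vanishes at negative indices; truncated
    subtraction alone would give [h 0] there. *)
Definition hdiff (a b : nat) : A := if (b <= a)%N then h (a - b)%N else 0.

Definition jacobi_trudi n (mu : nat -> nat) : A :=
  \det (\matrix_(i < n, j < n) hdiff (mu i + j) i).

(** The shape left when the special rim hook from the last row up to row [b] is removed, and also
    the shape belonging to the minor without row [b] and the last column. *)
Definition remove_row (mu : nat -> nat) (b i : nat) : nat :=
  if (i < b)%N then mu i else (mu i.+1).-1.

Lemma eq_jacobi_trudi n mu nu :
  (forall i, (i < n)%N -> mu i = nu i) -> jacobi_trudi n mu = jacobi_trudi n nu.
Proof.
by move=> eq_mu; congr (\det _); apply/matrixP=> i j; rewrite !mxE eq_mu.
Qed.

Hypothesis h0 : h 0 = 1.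

Lemma jacobi_trudi_trailing0 n mu :
  mu n = 0%N -> jacobi_trudi n.+1 mu = jacobi_trudi n mu.
Proof.
move=> mun0; rewrite /jacobi_trudi (expand_det_row _ ord_max) big_ord_recr /=.
rewrite big1 ?add0r => [|j _]; last first.
  by rewrite mxE /hdiff /= mun0 add0n leqNgt ltn_ord mul0r.
rewrite mxE /hdiff /= mun0 add0n leqnn subnn h0 mul1r /cofactor /=.
rewrite addnn -signr_odd odd_double mul1r.
congr (\det _); apply/matrixP=> i j; rewrite !mxE /=.
by rewrite /bump (leqNgt n i) (leqNgt n j) !ltn_ord !add0n.
Qed.

Lemma jacobi_trudi_widen n p mu : (n <= p)%N -> (forall i, (n <= i)%N -> mu i = 0%N) ->
  jacobi_trudi p mu = jacobi_trudi n mu.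
Proof.
move=> /subnKC <- mu0; elim: (p - n)%N => [|k IHk]; rewrite ?addn0 // addnS.
by rewrite jacobi_trudi_trailing0 // mu0 ?leq_addr.
Qed.

(** Deleting row [b] moves row [i.+1] to place [i], where the index [mu i.+1 + j - i.+1] reads
    [(mu i.+1).-1 + j - i]. Positivity of the parts keeps the predecessor exact. *)
Lemma jacobi_trudi_remove_row n mu : (forall i, (i <= n)%N -> (0 < mu i)%N) ->
  jacobi_trudi n.+1 mu =
  \sum_(b < n.+1) (-1) ^+ (n - b) * h (mu b + n - b)%N *
                  jacobi_trudi n (remove_row mu b).
Proof.
move=> mu_gt0; rewrite /jacobi_trudi (expand_det_col _ ord_max).
apply: eq_bigr => b _; rewrite mxE /hdiff /=.
have le_bn: (b <= n)%N by rewrite -ltnS.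
rewrite (leq_trans le_bn (leq_addl _ _)) [_ * h _]mulrC -mulrA; congr (_ * _).
rewrite /cofactor /=; congr (_ * _).
  exact: signr_addB.
congr (\det _); apply/matrixP=> i j; rewrite !mxE /=.
rewrite /bump (leqNgt n j) ltn_ord add0n /remove_row.
rewrite (ltnNge i b); case: (leqP b i) => //= le_bi.
have := mu_gt0 i.+1 (ltn_ord i); rewrite add1n.
by case: (mu i.+1) => // k _; rewrite /= addSn ltnS subSS.
Qed.

Variable M : nat.
Hypothesis h_large : forall m, (M < m)%N -> h m = 0.

Lemma hdiffSS a b : hdiff a.+1 b.+1 = hdiff a b.
Proof. by rewrite /hdiff ltnS subSS. Qed.

Lemma hdiff_large n a b : (M + n < a)%N -> (b <= n)%N -> hdiff a b = 0.
Proof.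
move=> ltMa le_bn; rewrite /hdiff; case: leqP => // _; apply: h_large.
by rewrite ltn_subRL (leq_ltn_trans _ ltMa) // addnC leq_add2l.
Qed.


Definition horizontal_strip n (la mu : nat -> nat) :=
  [forall i : 'I_n.+1, (mu i <= la i)%N && ((0 < i)%N ==> (la i <= mu i.-1)%N)].

Section Pieri.
Variables (n : nat) (mu : nat -> nat) (B : nat).
Hypothesis mu_dec : forall i, (mu i.+1 <= mu i)%N.
Hypothesis mun0 : mu n = 0%N.
Hypothesis ltB : (M + n < B)%N.
Hypothesis mu0B : (mu 0 < B)%N.

Let muB i : (mu i < B)%N.
Proof. by elim: i => // i; apply: leq_ltn_trans. Qed.

(* Row [i] sums, with weight ['X] to the power of the growth, the rows obtained
   by letting the part [mu i] grow. *)
Let Q : 'M[{poly A}]_n.+1 :=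
  \matrix_(i, j) \sum_(mu i <= q < B) (hdiff (q + j) i)%:P * 'X^(q - mu i).

Let H : {poly A} := \sum_(0 <= q < B) (h q)%:P * 'X^q.

(** Right multiplication by [E] subtracts ['X] times column [j.+1] from column [j]. Left
    multiplication by [L] subtracts from row [i] the multiple of row [i.-1] that cancels growth
    beyond [mu i.-1]. Both matrices are unitriangular. *)
Let E : 'M[{poly A}]_n.+1 :=
  \matrix_(i, j) ((i == j)%:R - 'X *+ (i == j.+1 :> nat)).

Let L : 'M[{poly A}]_n.+1 :=
  \matrix_(i, j) ((i == j)%:R - 'X^((mu j - mu i).+1) *+ (i == j.+1 :> nat)).

(** After the column operations each entry outside the last column telescopes to its lowest term,
    the boundary term at [B] being 0 because [M + n < B]. Since [mu n = 0], the last row is then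
    zero except for its corner [H]. *)
Lemma det_QE : \det Q = H * (jacobi_trudi n mu)%:P.
Proof.
have detE : \det E = 1.
  rewrite det_trig; last first.
    apply/is_trig_mxP => i j ltij; rewrite mxE.
    rewrite -val_eqE /= ltn_eqF // ltn_eqF ?subr0 //.
    exact: ltn_trans ltij (leqnn _).
  by rewrite big1 // => i _; rewrite mxE eqxx ltn_eqF ?subr0.
rewrite -[LHS]mulr1 -detE -det_mulmx.
have QE i j : (Q *m E) i j =
    if (j < n)%N then (hdiff (mu i + j) i)%:P else Q i j.
  rewrite mxE (bigD1 j) //= [E j j]mxE eqxx ltn_eqF // subr0 mulr1.
  case: ifPn => [ltjn|]; last first.
    rewrite -leqNgt => lenj; rewrite big1 ?addr0 // => k nekj.
    rewrite [E k j]mxE (negPf nekj) ltn_eqF ?subr0 ?mulr0 //.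
    exact: leq_trans (ltn_ord k) _.
  have ltj1 : (j.+1 < n.+1)%N by [].
  rewrite (bigD1 (Ordinal ltj1)) /=; last by rewrite -val_eqE /= gtn_eqF.
  rewrite big1 ?addr0 => [|k /andP[nekj nekj1]]; last first.
    rewrite [E k j]mxE (negPf nekj); move: nekj1; rewrite -val_eqE /= => /negPf ->.
    by rewrite subr0 mulr0.
  rewrite !mxE /= -val_eqE /= gtn_eqF // eqxx sub0r mulr1n mulrN.
  rewrite mulr_suml -sumrB.
  rewrite (@telescope_sumr_eq _ _ _
    (fun q => - ((hdiff (q + j) i)%:P * 'X^(q - mu i)))).
  - rewrite (@hdiff_large n) ?polyC0 ?mul0r ?oppr0 ?sub0r ?opprK ?subnn ?mulr1 //.
      exact: leq_trans ltB (leq_addr _ _).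
    by rewrite -ltnS.
  - exact/ltnW/muB.
  move=> q /andP[leq1 _]; rewrite opprK [RHS]addrC; congr (_ - _).
  by rewrite addnS -addSn subSn // exprSr mulrA.
rewrite (expand_det_row _ ord_max) big_ord_recr /= big1 ?add0r => [|j _]; last first.
  rewrite QE /= ltn_ord mun0 /hdiff leqNgt add0n.
  by rewrite (leq_trans (ltn_ord j)) ?polyC0 ?mul0r.
rewrite QE ltnn !mxE /= mun0; congr (_ * _).
  by apply: eq_bigr => q _; rewrite subn0 /hdiff leq_addl addnK.
rewrite /cofactor /= addnn -signr_odd odd_double mul1r.
rewrite /jacobi_trudi -det_map_mx; congr (\det _).
apply/matrixP=> i j; rewrite [LHS]mxE [LHS]mxE QE !mxE /= /bump.
by rewrite (leqNgt n j) (leqNgt n i) !ltn_ord !add0n.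
Qed.

(** Multiplied by its power of ['X] and reindexed by [q -> q.+1], row [i.-1] becomes the part of row
    [i] with [q > mu i.-1]; subtracting it leaves the interlacing values of [q]. *)
Lemma det_LQ : \det Q =
  \det (\matrix_(i < n.+1, j < n.+1)
    \sum_(q < B | (mu i <= q)%N && ((0 < i)%N ==> (q <= mu i.-1)%N))
       'X^(q - mu i) * (hdiff (q + j) i)%:P).
Proof.
have detL : \det L = 1.
  rewrite det_trig; last first.
    apply/is_trig_mxP => i j ltij; rewrite mxE.
    rewrite -val_eqE /= ltn_eqF // ltn_eqF ?subr0 //.
    exact: ltn_trans ltij (leqnn _).
  by rewrite big1 // => i _; rewrite mxE eqxx ltn_eqF ?subr0.
rewrite -[LHS]mul1r -detL -det_mulmx; congr (\det _); apply/matrixP => i j.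
have Qsum (P : pred nat) c : \sum_(c <= q < B | P q) (hdiff (q + j) i)%:P * 'X^(q - mu i)
    = \sum_(q < B | (c <= q)%N && P q) 'X^(q - mu i) * (hdiff (q + j) i)%:P.
  rewrite -(big_mkord (fun q => (c <= q)%N && P q)
     (fun q => 'X^(q - mu i) * (hdiff (q + j) i)%:P)) (big_nat_widenl _ 0) //.
  by apply: eq_big => [q|q _]; rewrite 1?andbC // mulrC.
rewrite !mxE (bigD1 i) //= [L i i]mxE eqxx ltn_eqF // subr0 mul1r.
case: (posnP i) => [i0|i_gt0].
  rewrite big1 ?addr0 => [|k neki]; last first.
    by rewrite [L i k]mxE i0 eq_sym (negPf neki) subr0 mul0r.
  rewrite mxE (Qsum predT); by apply: eq_bigl => q; rewrite i0.
have lti1 : (i.-1 < n.+1)%N by rewrite (leq_ltn_trans (leq_pred i)).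
rewrite (bigD1 (Ordinal lti1)) /=; last by rewrite -val_eqE /= ltn_eqF ?prednK.
rewrite big1 ?addr0 => [|k /andP[neki neki1]]; last first.
  rewrite [L i k]mxE eq_sym (negPf neki) -[in (_ == k.+1)](prednK i_gt0) eqSS eq_sym.
  by move: neki1; rewrite -val_eqE /= => /negPf ->; rewrite subr0 mul0r.
rewrite !mxE /= -val_eqE /= gtn_eqF ?prednK // eqxx sub0r mulr1n mulNr.
rewrite (Qsum predT) mulr_sumr.
have le_mu : (mu i <= mu i.-1)%N by rewrite -{1}(prednK i_gt0).
have -> : \sum_(mu i.-1 <= q < B) 'X^((mu i.-1 - mu i).+1) *
      ((hdiff (q + j) i.-1)%:P * 'X^(q - mu i.-1)) =
    \sum_(q < B | (mu i.-1 < q)%N) 'X^(q - mu i) * (hdiff (q + j) i)%:P.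
  transitivity (\sum_((mu i.-1).+1 <= q < B.+1) 'X^(q - mu i) * (hdiff (q + j) i)%:P).
    rewrite big_add1 /=; apply: eq_big_nat => q /andP[leq1 ltq].
    rewrite mulrCA mulrC -exprD addSn addnC addnBA // subnK //.
    have -> : hdiff (q.+1 + j) i = hdiff (q + j) i.-1.
      by rewrite -{1}(prednK i_gt0) addSn hdiffSS.
    by rewrite subSn // (leq_trans le_mu).
  rewrite big_nat_recr ?muB //= (@hdiff_large n) ?polyC0 ?mulr0 ?addr0; first last.
  - by rewrite -ltnS.
  - exact: leq_trans ltB (leq_addr _ _).
  by rewrite (big_nat_widenl _ 0) // big_mkord; apply: eq_bigl.
rewrite [X in X - _](bigID (fun q : 'I_B => (q <= mu i.-1)%N)) /=.
rewrite [X in _ + X - _](eq_bigl (fun q : 'I_B => mu i.-1 < q)%N) ?addrK.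
  by apply: eq_bigl => q; rewrite andbT.
move=> q; rewrite -ltnNge andbT; case: (ltnP (mu i.-1)) => lq; rewrite ?andbF //.
by rewrite (leq_trans le_mu (ltnW lq)).
Qed.

(* The generating function [\det Q] is evaluated in two ways: column operations
   give [H * jacobi_trudi n mu], row operations cancel all summands which are
   not horizontal strips. *)
Lemma pieri m : (m < B)%N ->
  h m * jacobi_trudi n mu =
  \sum_(la : {ffun 'I_n.+1 -> 'I_B} |
        horizontal_strip n (extend0 la) mu &&
        (\sum_i la i == \sum_(i < n.+1) mu i + m)%N)
    jacobi_trudi n.+1 (extend0 la).
Proof.
move=> ltmB.
have -> : h m * jacobi_trudi n mu = (\det Q)`_m.
  rewrite det_QE coefMC; congr (_ * _); rewrite coef_sum.
  rewrite big_mkord (bigD1 (Ordinal ltmB)) //= coefCM coefXn eqxx mulr1.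
  rewrite big1 ?addr0 // => q neq; rewrite coefCM coefXn eq_sym.
  by move: neq; rewrite -val_eqE /= => /negPf->; rewrite mulr0.
rewrite det_LQ /determinant.
have Dt (s : 'S_n.+1) :
  \prod_(i < n.+1) (\matrix_(i, j)
    \sum_(q < B | (mu i <= q)%N && ((0 < i)%N ==> (q <= mu i.-1)%N))
       'X^(q - mu i) * (hdiff (q + j) i)%:P) i (s i) =
  \sum_(la : {ffun 'I_n.+1 -> 'I_B} | horizontal_strip n (extend0 la) mu)
     'X^(\sum_i (la i - mu i)) * (\prod_i hdiff (la i + s i) i)%:P.
  under eq_bigr do rewrite mxE.
  rewrite bigA_distr_big_dep; apply: eq_big => la.
    by apply/familyP/forallP => /= hla i; have := hla i; rewrite unfold_in extend0_ord.
  by move=> _; rewrite big_split /= -expr_sum rmorph_prod.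
under eq_bigr => s _ do rewrite Dt mulr_sumr.
rewrite exchange_big /= coef_sum [RHS]big_mkcondr /=; apply: eq_bigr => la strip_la.
(* On a strip no difference [la i - mu i] is truncated, so the size condition says that the exponent
   of ['X] is [m]. *)
have -> : (\sum_i la i == \sum_(i < n.+1) mu i + m)%N =
    (m == \sum_i (la i - mu i))%N.
  have mu_la (i : 'I_n.+1) : true -> (mu i <= la i)%N.
    by have /forallP/(_ i) := strip_la; rewrite extend0_ord => /andP[].
  rewrite sumnB // -[RHS](eqn_add2l (\sum_(i < n.+1) mu i)) subnKC 1?eq_sym //.
  exact: leq_sum.
set K := (\sum_i _)%N.
have -> : \sum_(s : 'S_n.+1) (-1) ^+ s * ('X^K * (\prod_i hdiff (la i + s i) i)%:P) =
    'X^K * (jacobi_trudi n.+1 (extend0 la))%:P.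
  rewrite /jacobi_trudi /determinant rmorph_sum mulr_sumr; apply: eq_bigr => s _.
  rewrite rmorphM rmorph_sign mulrCA; congr (_ * (_ * _%:P)).
  by apply: eq_bigr => i _; rewrite mxE extend0_ord.
by rewrite coefMC coefXn; case: eqP => _; rewrite ?mul1r ?mul0r.
Qed.
End Pieri.

(** The Kostka number, by removal of the horizontal strip of the largest entry: entries lie below
    [n], and [alpha k] of them equal [k]. At [n = 0] the shape is not inspected, so the meaning is
    right only for [la] vanishing from [n] on. *)
Fixpoint kostka B n (la alpha : nat -> nat) : nat :=
  if n is n'.+1 then
    (\sum_(mu : {ffun 'I_n' -> 'I_B} |
        horizontal_strip n' la (extend0 mu) &&
        (\sum_(i < n) la i == \sum_i mu i + alpha n'))
      kostka B n' (extend0 mu) alpha)%N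
  else 1%N.

(** A strip over [mu] gives [la i.+1 <= mu i <= la i]. Hence functions that are not partitions carry
    coefficient 0 in sums weighted by Kostka numbers. *)
Lemma kostka_neq0_decr B n la alpha : (forall i, (n <= i)%N -> la i = 0%N) ->
  kostka B n la alpha != 0%N -> forall i, (la i.+1 <= la i)%N.
Proof.
case: n => [|n] la0 + i; first by rewrite !la0.
rewrite /= sum_nat_eq0 => /forallPn[mu]; rewrite negb_imply -andbA.
case/and3P=> /forallP strip _ _; case: (ltnP i n) => [lt_in|le_ni].
  have lt_i1 : (i.+1 < n.+1)%N by [].
  have /andP[_ /=] := strip (Ordinal lt_i1); move/leq_trans; apply.
  by have /andP[] := strip (Ordinal (ltnW lt_i1)).
by rewrite la0.
Qed.

Lemma eq_kostka B n la nu alpha : la =1 nu -> kostka B n la alpha = kostka B n nu alpha.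
Proof.
move=> eq_ln; case: n => //= n; apply: eq_bigl => mu; congr (_ && _).
  by apply: eq_forallb => i; rewrite eq_ln.
by rewrite (eq_bigr (fun i : 'I_n.+1 => nu i)).
Qed.

Lemma kostka_size B n la alpha : (forall i, (n <= i)%N -> la i = 0%N) ->
  kostka B n la alpha != 0%N -> (\sum_(i < n) la i = \sum_(k < n) alpha k)%N.
Proof.
elim: n la => [|n IHn] la la0; first by rewrite !big_ord0.
rewrite /= sum_nat_eq0 => /forallPn[mu]; rewrite negb_imply -andbA.
case/and3P=> _ /eqP-> K0; rewrite [RHS]big_ord_recr /=; congr (_ + _)%N.
rewrite -(IHn (extend0 mu)) //; first by apply: eq_bigr => i _; rewrite extend0_ord.
by move=> i; apply: extend0_ge.
Qed.

(** Each new factor is absorbed by the Pieri rule; exchanging the sums over [la] and [mu] then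
    produces the recursion of [kostka]. *)
Lemma prod_kostka B n alpha : (M + n < B)%N ->
  (forall k, (k < n)%N -> (alpha k < B)%N) ->
  \prod_(k < n) h (alpha k) =
  \sum_(la : {ffun 'I_n -> 'I_B})
    jacobi_trudi n (extend0 la) *+ kostka B n (extend0 la) alpha.
Proof.
elim: n => [|n IHn] ltB alphaB.
  rewrite big_ord0; have la0 : {ffun 'I_0 -> 'I_B} by apply: finfun => -[].
  rewrite (bigD1 la0) //= /jacobi_trudi det_mx00 big1 ?addr0 // => la.
  by case/eqP; apply/ffunP=> -[].
have ltB' : (M + n < B)%N by apply: ltn_trans ltB; rewrite addnS.
have B0 : (0 < B)%N by apply: leq_ltn_trans ltB'.
rewrite big_ord_recr /= IHn //; last by move=> k /ltnW; apply: alphaB.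
under [RHS]eq_bigr do rewrite -sumrMnr.
rewrite mulr_suml (exchange_big_dep predT) //=; apply: eq_bigr => mu _.
have [->|K0] := eqVneq (kostka B n (extend0 mu) alpha) 0%N.
  by rewrite mulr0n mul0r big1.
rewrite mulrnAl mulrC (@pieri n (extend0 mu) B) ?alphaB ?extend0_lt //.
- rewrite -sumrMnl; apply: eq_big => [la|//]; congr (_ && (_ == _ + _)%N).
    by apply: eq_bigr => i _; rewrite extend0_ord.
  rewrite big_ord_recr /= extend0_ge // addn0.
  by apply: eq_bigr => i _; rewrite extend0_ord.
- by apply: kostka_neq0_decr K0 => i; apply: extend0_ge.
- exact: extend0_ge.
Qed.
End JacobiTrudi.

(** * Special rim hooks of a diagram *)

Section Subdiagrams.
Variable la : seq nat.
Implicit Types (D r : {set cell la}) (c : cell la) (mu nu : nat -> nat).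

Lemma cell_inj c c' : crow c = crow c' -> ccol c = ccol c' -> c = c'.
Proof.
case: c c' => [i j] [i' j']; rewrite /crow /ccol /= => /val_inj ii'.
by case: i' / ii' j' => j' /val_inj ->.
Qed.

Lemma exists_cell i j : (j < nth 0 la i)%N -> exists c, crow c = i /\ ccol c = j.
Proof.
move=> lt_j; have lt_i : (i < size la)%N.
  by rewrite ltnNge; apply: contraL lt_j => /(nth_default 0%N) ->.
by exists (Tagged (fun i : 'I_(size la) => 'I_(nth 0%N la i))
  (i := Ordinal lt_i) (Ordinal (lt_j : j < nth 0 la (Ordinal lt_i))%N)).
Qed.

Definition subdiagram mu : {set cell la} := [set c | (ccol c < mu (crow c))%N].

Lemma in_subdiagram mu c : (c \in subdiagram mu) = (ccol c < mu (crow c))%N.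
Proof. by rewrite inE. Qed.

Lemma ccol_lt c : (ccol c < nth 0 la (crow c))%N.
Proof. exact: ltn_ord. Qed.

Definition decreasing mu := forall i, (mu i.+1 <= mu i)%N.

Lemma decreasing_leq mu i j : decreasing mu -> (i <= j)%N -> (mu j <= mu i)%N.
Proof.
move=> dec /subnKC <-; elim: (j - i)%N => [|k IHk]; rewrite ?addn0 // addnS.
exact: leq_trans (dec _) IHk.
Qed.

Definition shape_below mu := decreasing mu /\ forall i, (mu i <= nth 0 la i)%N.

Lemma row_len_subdiagram mu (i : 'I_(size la)) :
  (mu i <= nth 0 la i)%N -> row_len (subdiagram mu) i = mu i.
Proof.
move=> le_mu; rewrite /row_len.
pose f (j : 'I_(mu i)) : cell la :=
  Tagged (fun i : 'I_(size la) => 'I_(nth 0%N la i)) (widen_ord le_mu j).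
have f_inj : injective f.
  by move=> j j' /(congr1 (@ccol la)); rewrite /ccol /= => /val_inj.
rewrite -[RHS]card_ord -cardsT -(card_imset _ f_inj); apply: eq_card => c.
rewrite !inE; apply/andP/imsetP => [[lt_c /eqP ci]|[j _ ->]]; last first.
  by rewrite /ccol /crow /= eqxx ltn_ord.
have lt_c' : (ccol c < mu i)%N by rewrite -ci.
by exists (Ordinal lt_c') => //; apply: cell_inj; rewrite // /crow ci.
Qed.

Lemma is_diagram_subdiagram mu : shape_below mu -> is_diagram (subdiagram mu).
Proof.
case=> dec le_la; apply/andP; split.
  by apply/forallP=> c; rewrite row_len_subdiagram // in_subdiagram.
apply/forallP=> i; apply/forallP=> j; apply/implyP=> le_ij.
by rewrite !row_len_subdiagram // decreasing_leq.
Qed.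

Lemma is_diagramP D : is_diagram D -> exists2 mu, shape_below mu & D = subdiagram mu.
Proof.
case/andP=> /forallP memD /forallP decD.
pose mu i := if insub i is Some i' then row_len D i' else 0%N.
have muE (i : 'I_(size la)) : mu i = row_len D i by rewrite /mu valK.
exists mu; last by apply/setP=> c; rewrite in_subdiagram muE (eqP (memD c)).
split=> i.
  rewrite /mu; case: insubP => // j _ ji; have lt_i : (i < size la)%N.
    by rewrite -ltnS -ji ltnW // ltnS ltn_ord.
  rewrite insubT; have /forallP/(_ j)/implyP := decD (Ordinal lt_i); apply.
  by rewrite /= ji.
rewrite /mu; case: insubP => // j _ <-.
rewrite -[X in (_ <= X)%N](@row_len_subdiagram (nth 0 la)%N) //.
apply: subset_leq_card; apply/subsetP=> c; rewrite !inE => /andP[_ ->].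
by rewrite ccol_lt.
Qed.

(** The special rim hook that starts in the first column of the last row and ends in row [b]. In row
    [i >= b] it starts at column [(mu i.+1).-1]; in the last row the truncated predecessor makes
    this column 0. *)
Definition hook mu b := subdiagram mu :\: subdiagram (remove_row mu b).

Lemma in_hook mu b c : (c \in hook mu b) =
  [&& (b <= crow c)%N, ((mu (crow c).+1).-1 <= ccol c)%N & (ccol c < mu (crow c))%N].
Proof.
rewrite !inE /remove_row -leqNgt; case: (ltnP (crow c) b) => //= _.
by rewrite leqNgt andNb.
Qed.

Lemma remove_row_leq mu b i : decreasing mu -> (remove_row mu b i <= mu i)%N.
Proof.
move=> dec; rewrite /remove_row; case: ltnP => // _.
by rewrite (leq_trans (leq_pred _)).
Qed.

Lemma remove_row_below mu b : shape_below mu -> shape_below (remove_row mu b).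
Proof.
case=> dec le_la; split=> i; last exact: leq_trans (remove_row_leq _ _ dec) _.
rewrite /remove_row; case: ltnP => [lt_ib|le_bi].
  by rewrite (ltnW lt_ib) dec.
case: ltnP => _; last by rewrite -!subn1 leq_sub2r.
by rewrite (leq_trans (leq_pred _)) // decreasing_leq // leqW.
Qed.

Lemma subdiagramD_hook mu b : decreasing mu ->
  subdiagram mu :\: hook mu b = subdiagram (remove_row mu b).
Proof.
move=> dec; rewrite setDDr setDv set0U; apply/setIidPr/subsetP => c.
by rewrite !in_subdiagram => /leq_trans; apply; apply: remove_row_leq.
Qed.

Lemma adjacentC (a b : cell la) : adjacent a b = adjacent b a.
Proof.
rewrite /adjacent [crow b == crow a]eq_sym [ccol b == ccol a]eq_sym.
by congr (_ && _ || _ && _); apply: orbC.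
Qed.

Section Hooks.
Variables (n : nat) (mu : nat -> nat).
Hypotheses (mu_below : shape_below mu) (mu_gt0 : (0 < mu n)%N) (mu0 : mu n.+1 = 0%N).

Let dec : decreasing mu. Proof. by case: mu_below. Qed.

Lemma exists_subcell i j : (j < mu i)%N ->
  exists c, crow c = i /\ ccol c = j.
Proof. by case: mu_below => _ le_la lt_j; apply: exists_cell (leq_trans lt_j _). Qed.

Lemma mu_ge i : (n < i)%N -> mu i = 0%N.
Proof. by move=> lt_ni; apply/eqP; rewrite -leqn0 -mu0 decreasing_leq. Qed.

Lemma crow_le c : c \in subdiagram mu -> (crow c <= n)%N.
Proof.
by rewrite in_subdiagram [(_ <= n)%N]leqNgt; apply: contraL => /mu_ge ->.
Qed.

Lemma corner_in_hook b c : (b <= n)%N -> crow c = n -> ccol c = 0%N -> c \in hook mu b.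
Proof. by move=> le_bn cn c0; rewrite in_hook cn c0 mu0 le_bn mu_gt0. Qed.

Lemma hook_inj b b' : (b <= n)%N -> (b' <= n)%N -> hook mu b = hook mu b' -> b = b'.
Proof.
have key p q : (p <= n)%N -> hook mu p = hook mu q -> (q <= p)%N.
  move=> le_pn eq_hook; have mup : (0 < mu p)%N.
    by rewrite (leq_trans mu_gt0) // decreasing_leq.
  have [|c [cp cl]] := @exists_subcell p (mu p).-1; first by rewrite prednK.
  have: c \in hook mu p.
    by rewrite in_hook cp cl leqnn prednK // leqnn andbT -!subn1 leq_sub2r.
  by rewrite eq_hook in_hook cp => /andP[].
move=> le_b le_b' eqh; apply/eqP; rewrite eqn_leq.
by rewrite (key b' b) // (key b b').
Qed.

(** Each cell is joined to the bottom left corner: left while the hook continues in the row,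
    otherwise down. The distance [n - crow c + ccol c] decreases. *)
Lemma hook_connected b : (b <= n)%N -> connected_cells (hook mu b).
Proof.
move=> le_bn; pose e := [rel x y | [&& x \in hook mu b, y \in hook mu b & adjacent x y]].
have [corner [cn c0]] := @exists_subcell n 0 mu_gt0.
have e_sym : connect_sym e.
  apply: sym_connect_sym => x y /=; rewrite adjacentC.
  by case: (x \in _); case: (y \in _).
have to_corner k c : (n - crow c + ccol c <= k)%N -> c \in hook mu b ->
    connect e c corner.
  elim: k c => [|k IHk] c.
    rewrite leqn0 addn_eq0 subn_eq0 => /andP[le_nc /eqP cc0] c_hook.
    suff -> : c = corner by [].
    apply: cell_inj; rewrite ?cc0 ?c0 // cn; apply/eqP; rewrite eqn_leq le_nc.
    by rewrite crow_le //; move: c_hook; rewrite inE => /andP[].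
  move=> le_k c_hook; have := c_hook; rewrite in_hook => /and3P[le_bc ge_c lt_c].
  have [lt_ge|le_ge] := ltnP (mu (crow c).+1).-1 (ccol c).
    have c_gt0 : (0 < ccol c)%N by apply: leq_ltn_trans lt_ge.
    have [|c' [c'r c'l]] := @exists_subcell (crow c) (ccol c).-1.
      exact: leq_ltn_trans (leq_pred _) lt_c.
    have c'_hook : c' \in hook mu b.
      have le1 : ((mu (crow c).+1).-1 <= (ccol c).-1)%N by rewrite -ltnS (prednK c_gt0).
      rewrite in_hook c'r c'l le_bc le1.
      exact: leq_ltn_trans (leq_pred _) lt_c.
    apply: connect_trans (IHk c' _ c'_hook); last first.
      by rewrite c'r c'l -ltnS -addnS prednK.
    apply: connect1; rewrite /= c_hook c'_hook /adjacent c'r c'l prednK //.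
    by rewrite !eqxx orbT.
  have cE : ccol c = (mu (crow c).+1).-1 by apply/eqP; rewrite eqn_leq le_ge.
  have le_cn : (crow c <= n)%N by apply: crow_le; rewrite in_subdiagram.
  move: le_cn; rewrite leq_eqVlt => /predU1P[eq_cn|lt_cn].
    suff -> : c = corner by [].
    by apply: cell_inj; rewrite ?cn // c0 cE eq_cn mu0.
  have mu_c1 : (0 < mu (crow c).+1)%N.
    by rewrite (leq_trans mu_gt0) // decreasing_leq.
  have lt_c' : (ccol c < mu (crow c).+1)%N by rewrite cE prednK.
  have [c' [c'r c'l]] := exists_subcell lt_c'.
  have c'_hook : c' \in hook mu b.
    rewrite in_hook c'r c'l lt_c' (leq_trans le_bc) //= cE -!subn1.
    by rewrite leq_sub2r.
  apply: connect_trans (IHk c' _ c'_hook); last first.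
    by rewrite c'r c'l -ltnS -addSn -subSn // subSS.
  apply: connect1; rewrite /= c_hook c'_hook /adjacent c'r c'l.
  by rewrite !eqxx !orbT.
apply/forall_inP => a a_hook; apply/forall_inP => a' a'_hook.
apply: connect_trans (to_corner _ _ (leqnn _) a_hook) _.
by rewrite e_sym (to_corner _ _ (leqnn _) a'_hook).
Qed.

Lemma is_rim_hook_hook b : (b <= n)%N -> is_rim_hook (subdiagram mu) (hook mu b).
Proof.
move=> le_bn; have [corner [cn c0]] := @exists_subcell n 0 mu_gt0.
apply/and4P; split.
- by apply/set0Pn; exists corner; rewrite corner_in_hook.
- exact: hook_connected.
- apply/forall_inP => c; rewrite in_hook => /and3P[_ ge_c lt_c].
  rewrite /se_boundary in_subdiagram lt_c /=; apply/exists_inPn => c'.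
  rewrite in_subdiagram => lt_c'; apply/negP => /andP[/eqP c'r /eqP c'l].
  move: lt_c'; rewrite c'r c'l => lt_c'.
  by move: ge_c; rewrite leqNgt -ltnS prednK ?lt_c' // (leq_trans _ lt_c').
by rewrite subdiagramD_hook //; apply/is_diagram_subdiagram/remove_row_below.
Qed.

(** Let [nu] be the shape left by [r]. The boundary condition gives [(mu i.+1).-1 <= nu i]. A cell
    of [r] in the first column forces [nu n = 0], so [r] contains the bottom left corner. If [b] is
    the top row of [r], connectedness makes [r] cross from each row [i] with [b <= i < n] to the
    next within one column, whence [nu i <= (mu i.+1).-1]. *)
Lemma special_rim_hookP r : is_rim_hook (subdiagram mu) r ->
  (exists2 c, c \in r & ccol c = 0%N) -> exists2 b, (b <= n)%N & r = hook mu b.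
Proof.
case/and4P=> r_neq0 /forall_inP conn /forall_inP se diag [c0 c0r c00].
have [nu [dec_nu nu_la] Dr] := is_diagramP diag.
have r_sub c : c \in r -> c \in subdiagram mu by move/se => /andP[].
have in_r c : (c \in r) = (nu (crow c) <= ccol c < mu (crow c))%N.
  have: (c \in subdiagram mu :\: r) = (c \in subdiagram nu) by rewrite Dr.
  rewrite !inE [(nu _ <= _)%N]leqNgt => <-; case: (boolP (c \in r)) => /= [/r_sub|_].
    by rewrite in_subdiagram => ->.
  by rewrite andNb.
have nu_le i : (nu i <= mu i)%N.
  rewrite leqNgt; apply/negP => lt_mn; have [c [ci cm]] := exists_cell (leq_trans lt_mn (nu_la i)).
  have: c \in subdiagram nu by rewrite in_subdiagram ci cm.
  by rewrite -Dr inE in_subdiagram ci cm ltnn andbF.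
have nu_ge i : ((mu i.+1).-1 <= nu i)%N.
  rewrite leqNgt; apply/negP => lt_nu.
  have lt1 : (nu i < mu i)%N by rewrite (leq_trans lt_nu) // (leq_trans (leq_pred _)).
  have mu1 : ((nu i).+1 < mu i.+1)%N.
    by move: lt_nu; case: (mu i.+1).
  have [c [ci cm]] := exists_subcell lt1; have [c' [c'i c'm]] := exists_subcell mu1.
  have /se/andP[_ /exists_inPn/(_ c')] : c \in r by rewrite in_r ci cm leqnn.
  by rewrite in_subdiagram c'i c'm ci cm !eqxx mu1 => /(_ isT).
have nu0 : nu n = 0%N.
  apply/eqP; rewrite -leqn0; have := c0r; rewrite in_r c00 leqn0 => /andP[/eqP <- _].
  by rewrite decreasing_leq // crow_le // r_sub.
have [cn [cnn cn0]] := @exists_subcell n 0 mu_gt0.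
have cn_r : cn \in r by rewrite in_r cnn cn0 nu0 mu_gt0.
have [b]: exists b, (exists2 c, c \in r & crow c == b) /\
    forall c, c \in r -> (b <= crow c)%N.
  have ex_b : exists b, [exists c in r, crow c == b].
    by exists n; apply/exists_inP; exists cn; rewrite ?cnn.
  exists (ex_minn ex_b); case: ex_minnP => m /exists_inP m_r m_min; split=> // c c_r.
  by apply: m_min; apply/exists_inP; exists c.
case=> -[c1 c1r /eqP c1b] b_min.
have le_bn : (b <= n)%N by rewrite -c1b crow_le // r_sub.
exists b => //; apply/setP => c; rewrite in_hook in_r.
have [lt_cb|le_bc] := ltnP (crow c) b.
  by rewrite -in_r; apply: contraTF lt_cb => /b_min; rewrite -leqNgt.
suff -> : nu (crow c) = (mu (crow c).+1).-1 by [].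
apply/eqP; rewrite eqn_leq nu_ge andbT.
have [lt_cn|le_nc] := ltnP (crow c) n; last first.
  by rewrite (leq_trans (decreasing_leq dec_nu le_nc)) // nu0.
have /connectP[p] := forall_inP (conn c1 c1r) cn cn_r.
rewrite -/(crow c); move: (crow c) le_bc lt_cn => i le_bi lt_in p_path p_last.
(* A path from row [b] to the corner has a first step that leaves the rows up to [i]; its two cells
   are adjacent in different rows, so they share a column. *)
have [a [a' [a_r a'_r adj le_ai lt_ia']]] : exists a a',
    [/\ a \in r, a' \in r, adjacent a a', (crow a <= i)%N & (i < crow a')%N].
  have : (crow c1 <= i)%N by rewrite c1b.
  elim: p c1 {c1r c1b} p_path p_last => [|x p IHp] y /=.
    by move=> _ <-; rewrite cnn leqNgt lt_in.
  case/andP=> /and3P[y_r x_r adj] p_path p_last le_y.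
  by have [/IHp|lt_ix] := leqP (crow x) i; [apply | exists y, x].
have [aE a'E lE] : [/\ crow a = i, crow a' = i.+1 & ccol a = ccol a'].
  move: adj; rewrite /adjacent => /orP[/andP[/eqP eq_r _]|/andP[/eqP eq_c]].
    by move: lt_ia'; rewrite -eq_r ltnNge le_ai.
  case/orP=> /eqP eq_r; last first.
    by move: lt_ia'; rewrite ltnNge (leq_trans _ le_ai) // eq_r ltnW.
  rewrite eq_r ltnS in lt_ia'; have eq_a : crow a = i by apply/eqP; rewrite eqn_leq le_ai.
  by split; rewrite // eq_r eq_a.
move: a_r a'_r; rewrite !in_r aE a'E lE => /andP[le_nu _] /andP[_ lt_mu].
by rewrite (leq_trans le_nu) // -ltnS (ltn_predK lt_mu).
Qed.
End Hooks.
End Subdiagrams.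

(** * Special rim hook tilings *)

Section Tilings.
Variable la : seq nat.
Implicit Types (D r : {set cell la}) (c : cell la) (mu nu : nat -> nat).
Implicit Types (t : {set {set cell la}}) (s : seq {set cell la}).

(** Special rim hook tilings of an arbitrary [D], as the recursion on shapes requires; for the full
    set of cells this is [is_srh_tabloid] by conversion. *)
Definition special_tiling D t : bool :=
  has (strips_off D) (permutations (enum t)) &&
  [forall r in t, exists c in r, ccol c == 0%N].

Lemma is_rim_hook_sub D r : is_rim_hook D r -> r \subset D.
Proof.
by case/and4P=> _ _ /forall_inP se _; apply/subsetP=> c /se/andP[].
Qed.

Lemma strips_off_sub D s r : strips_off D s -> r \in s -> r != set0 /\ r \subset D.
Proof.
elim: s D => //= r' s IHs D /andP[rim_r' strip_s]; rewrite inE => /predU1P[->|].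
  by split; [case/and4P: rim_r' | apply: is_rim_hook_sub].
by case/(IHs _ strip_s) => r0 /subset_trans-> //; apply: subsetDl.
Qed.

Lemma strips_off_notin D r s : strips_off (D :\: r) s -> r \notin s.
Proof.
move=> strip_s; apply/negP => /(strips_off_sub strip_s)[r0].
by rewrite subsetD -setI_eq0 setIid (negPf r0) andbF.
Qed.

Lemma strips_off_uniq D s : strips_off D s -> uniq s.
Proof.
by elim: s D => //= r s IHs D /andP[_ strip_s]; rewrite (strips_off_notin strip_s) (IHs _ strip_s).
Qed.

Lemma special_tilingP D t :
  reflect (exists s, [/\ strips_off D s, t = [set:: s] &
                      forall r, r \in s -> exists2 c, c \in r & ccol c = 0%N])
          (special_tiling D t).
Proof.
apply: (iffP andP) => [[/hasP[s s_t strip_s] /forall_inP special]|[s [strip_s -> special]]].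
  have mem_s : s =i t.
    by move=> r; rewrite -(mem_enum t); apply: perm_mem; rewrite -mem_permutations.
  exists s; split=> // [|r]; first by apply/setP=> r; rewrite inE mem_s.
  by rewrite mem_s => /special/exists_inP[c c_r /eqP c0]; exists c.
split; last first.
  apply/forall_inP => r; rewrite inE => /special[c c_r c0].
  by apply/exists_inP; exists c; rewrite ?c0.
apply/hasP; exists s => //; rewrite mem_permutations; apply: uniq_perm.
- exact: strips_off_uniq strip_s.
- exact: enum_uniq.
- by move=> r; rewrite mem_enum inE.
Qed.

Lemma special_tiling0 t : special_tiling set0 t = (t == set0).
Proof.
apply/special_tilingP/eqP => [[s [strip_s -> _]]|->].
  case: s strip_s => [_|r s /strips_off_sub/(_ (mem_head _ _))[]].
    by apply/setP=> r; rewrite !inE.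
  by rewrite subset0 => /negPf->.
by exists [::]; split=> //=; apply/setP => r; rewrite !inE.
Qed.

Lemma strips_off_partition D s : strips_off D s -> partition [set:: s] D.
Proof.
elim: s D => [|r s IHs] D /=.
  move/eqP->; have -> : [set:: [::]] = set0 :> {set {set cell la}}.
    by apply/setP=> x; rewrite !inE.
  by rewrite partition_set0.
case/andP=> rim_r strip_s; have r_sub := is_rim_hook_sub rim_r.
have /and4P[r0 _ _ _] := rim_r.
have -> : [set:: r :: s] = r |: [set:: s] by apply/setP=> x; rewrite !inE.
have -> : D = r :|: (D :\: r) by rewrite -{1}(setID D r) (setIidPr r_sub).
apply: partitionU1 => //; first exact: IHs.
by rewrite disjoint_sym disjoints_subset subsetDr.
Qed.

Section Recursion.
Variables (n : nat) (mu : nat -> nat).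
Hypotheses (mu_below : shape_below la mu) (mu_gt0 : (0 < mu n)%N) (mu0 : mu n.+1 = 0%N).

Let dec : decreasing mu. Proof. by case: mu_below. Qed.

(** The hook stripped first is special, hence some [hook la mu b]. All these hooks contain the
    bottom left cell and the hooks of a tiling are disjoint, so [b] depends on the tiling and not on
    the stripping order. *)
Lemma special_tiling_remove t : special_tiling (subdiagram la mu) t ->
  exists b : 'I_n.+1, [/\ hook la mu b \in t,
    special_tiling (subdiagram la (remove_row mu b)) (t :\ hook la mu b) &
    forall b' : 'I_n.+1, (hook la mu b' \in t) = (b' == b)].
Proof.
case/special_tilingP => -[|r s] /= [strip_s -> special].
  have [c [cn c0]] := exists_subcell mu_below mu_gt0.
  have: c \in subdiagram la mu by rewrite in_subdiagram cn c0.
  by rewrite (eqP strip_s) inE.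
have /andP[rim_r {}strip_s] := strip_s.
have [b le_bn rE] := special_rim_hookP mu_below mu_gt0 mu0 rim_r (special r (mem_head _ _)).
exists (Ordinal (le_bn : b < n.+1)%N); split=> /=.
- by rewrite !inE rE eqxx.
- apply/special_tilingP; exists s; split.
  + by rewrite -subdiagramD_hook // -rE.
  + apply/setP=> r'; rewrite !inE -rE; case: eqP => //= ->.
    by rewrite (negPf (strips_off_notin strip_s)).
  + by move=> r' r'_s; apply: special; rewrite inE r'_s orbT.
move=> b'; rewrite in_set in_cons -[b' == _]val_eqE /= rE.
have le_b'n : (b' <= n)%N by rewrite -ltnS.
have [eq_h|neq_h] /= := eqVneq (hook la mu b') (hook la mu b).
  by rewrite (hook_inj mu_below mu_gt0 le_b'n le_bn eq_h) !eqxx.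
have [c [cn c0]] := exists_subcell mu_below mu_gt0.
case: eqP => [eq_b|_]; first by rewrite eq_b eqxx in neq_h.
apply/negP => /(strips_off_sub strip_s)[_ /subsetP/(_ c)].
by rewrite rE (corner_in_hook mu_gt0 mu0) // inE (corner_in_hook mu_gt0 mu0) // => /(_ isT).
Qed.

Lemma special_tiling_add (b : 'I_n.+1) t :
  special_tiling (subdiagram la (remove_row mu b)) t ->
  special_tiling (subdiagram la mu) (hook la mu b |: t) /\ hook la mu b \notin t.
Proof.
have le_bn : (b <= n)%N by rewrite -ltnS.
have [c [cn c0]] := exists_subcell mu_below mu_gt0.
case/special_tilingP => s [strip_s -> special].
rewrite -subdiagramD_hook // in strip_s; split.
  apply/special_tilingP; exists (hook la mu b :: s); split=> /=.
  - by rewrite strip_s (is_rim_hook_hook mu_below mu_gt0 mu0 le_bn).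
  - by apply/setP => r; rewrite !inE.
  move=> r; rewrite inE => /predU1P[->|/special //].
  by exists c => //; apply: (corner_in_hook mu_gt0 mu0).
by rewrite inE (strips_off_notin strip_s).
Qed.

Variables (A : comNzRingType) (g : {set cell la} -> A).

Definition tiling_sum D : A := \sum_(t | special_tiling D t) \prod_(r in t) g r.

Lemma tiling_sum_rec : tiling_sum (subdiagram la mu) =
  \sum_(b < n.+1) g (hook la mu b) * tiling_sum (subdiagram la (remove_row mu b)).
Proof.
rewrite /tiling_sum.
(* The inner sum has exactly one term, the hook of [t] through the bottom left cell. *)
transitivity (\sum_(t | special_tiling (subdiagram la mu) t)
    \sum_(b < n.+1 | hook la mu b \in t) \prod_(r in t) g r).
  apply: eq_bigr => t /special_tiling_remove[b [_ _ uniq_b]].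
  by rewrite (big_pred1 b).
rewrite (exchange_big_dep predT) //=; apply: eq_bigr => b _.
rewrite mulr_sumr (reindex_onto (fun t => hook la mu b |: t)
  (fun t => t :\ hook la mu b)) /=; last first.
  by move=> t /andP[_ b_t]; rewrite setD1K.
apply: eq_big => [t|t /andP[_ /eqP Dt]]; last first.
  by rewrite big_setU1 // -Dt !inE eqxx.
rewrite setU11 andbT; apply/andP/idP => [[till /eqP Dt]|/special_tiling_add[-> nt]].
  have [b' [_ till' uniq_b]] := special_tiling_remove till.
  have := uniq_b b; rewrite setU11 => /esym/eqP bb'.
  by rewrite -bb' Dt in till'.
by rewrite setU1K.
Qed.
End Recursion.

Lemma tiling_sum0 (A : comNzRingType) (g : {set cell la} -> A) : tiling_sum g set0 = 1.
Proof. by rewrite /tiling_sum (big_pred1 set0) ?big_set0 // => t; apply: special_tiling0. Qed.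
End Tilings.

(** * Signed sums over special rim hook tilings *)

Section Reading.
Variable la : seq nat.
Implicit Types (D r : {set cell la}) (c : cell la) (mu nu : nat -> nat).

Lemma sw_ne_total : total (@sw_ne la).
Proof. by move=> a b; rewrite /sw_ne; case: ltngtP => //= _; apply: leq_total. Qed.

Lemma sw_ne_trans : transitive (@sw_ne la).
Proof.
move=> b a c; rewrite /sw_ne => /orP[lt_ba|/andP[/eqP -> le_ab]].
  case/orP=> [lt_cb|/andP[/eqP <- _]]; last by rewrite lt_ba.
  by rewrite (ltn_trans lt_cb).
by case/orP=> [->//|/andP[/eqP -> /(leq_trans le_ab) ->]]; rewrite eqxx orbT.
Qed.

Lemma sw_ne_anti : antisymmetric (@sw_ne la).
Proof.
move=> a b; rewrite /sw_ne; case: ltngtP => //= eq_r.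
by rewrite -eqn_leq => /eqP eq_c; apply: cell_inj.
Qed.

Lemma mem_reading r : reading r =i r.
Proof. by move=> c; rewrite mem_sort mem_enum. Qed.

Lemma reading_uniq r : uniq (reading r).
Proof. by rewrite sort_uniq enum_uniq. Qed.

Lemma size_reading r : size (reading r) = #|r|.
Proof. by rewrite size_sort cardE. Qed.

Lemma reading_sorted r : sorted (@sw_ne la) (reading r).
Proof. exact/sort_sorted/sw_ne_total. Qed.

Lemma reading_unique r s :
  sorted (@sw_ne la) s -> uniq s -> s =i r -> reading r = s.
Proof.
move=> s_sorted s_uniq s_r; apply: (sorted_eq sw_ne_trans sw_ne_anti) => //.
  exact: reading_sorted.
by apply: uniq_perm => // [|c]; rewrite ?reading_uniq // mem_reading s_r.
Qed.

Lemma reading_setU r1 r2 :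
  (forall a b, a \in r1 -> b \in r2 -> sw_ne a b && (a != b)) ->
  reading (r1 :|: r2) = reading r1 ++ reading r2.
Proof.
move=> r12; apply: reading_unique => [||c]; last by rewrite mem_cat !mem_reading inE.
  rewrite sorted_pairwise ?pairwise_cat; last exact: sw_ne_trans.
  rewrite -!(sorted_pairwise sw_ne_trans) !reading_sorted !andbT.
  by apply/allrelP => a b; rewrite !mem_reading => ar br; case/andP: (r12 a b ar br).
rewrite cat_uniq !reading_uniq andbT /=; apply/hasPn => b; rewrite !mem_reading => br.
by apply/negP => ar; have := r12 b b ar br; rewrite eqxx andbF.
Qed.

Lemma reading1 c : reading [set c] = [:: c].
Proof. by apply: reading_unique => // a; rewrite !inE. Qed.

(** Row indices only decrease along a reading, so each row is met in one contiguous block. *)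
Lemma row_changes_sorted (s : seq (cell la)) : s != [::] -> sorted (@sw_ne la) s ->
  (count (fun ab : cell la * cell la => crow ab.1 != crow ab.2) (zip s (behead s))).+1
  = size (undup (map (@crow la) s)).
Proof.
case: s => // a s _; elim: s a => //= b s IHs a /andP[ab s_sorted].
rewrite -addnS IHs //=; move: ab; rewrite /sw_ne.
have [lt_ba _|//|eq_ab _] := ltngtP (crow b) (crow a); last first.
  by rewrite eq_ab inE eqxx.
suff na : crow a \notin crow b :: [seq crow i | i <- s] by rewrite (negPf na).
rewrite inE negb_or gtn_eqF //=; apply/mapP => -[c c_s ac].
have := order_path_min sw_ne_trans s_sorted => /allP/(_ c c_s).
by rewrite /sw_ne -ac ltnNge (ltnW lt_ba) ltn_eqF.
Qed.

Lemma card_subdiagram mu n : shape_below la mu -> (forall i, (n <= i)%N -> mu i = 0%N) ->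
  #|subdiagram la mu| = (\sum_(i < n) mu i)%N.
Proof.
case=> _ mu_la mu0.
have trunc p q : (forall i, (p <= i)%N -> mu i = 0%N) -> (p <= q)%N ->
    (\sum_(i < q) mu i = \sum_(i < p) mu i)%N.
  move=> mup le_pq; rewrite -!(big_mkord predT mu) (big_cat_nat (leq0n p) le_pq) //=.
  rewrite [X in (_ + X)%N]big_nat_cond [X in (_ + X)%N]big1 ?addn0 //.
  by move=> i; rewrite andbT => /andP[/mup].
have mus i : (size la <= i)%N -> mu i = 0%N.
  by move=> le_i; apply/eqP; rewrite -leqn0 -(nth_default 0%N le_i).
have -> : (\sum_(i < n) mu i = \sum_(i < size la) mu i)%N.
  case/orP: (leq_total n (size la)) => le; first by rewrite (trunc n (size la)).
  by rewrite (trunc (size la) n).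
rewrite -sum1_card (partition_big (@tag _ _) predT) //=; apply: eq_bigr => i _.
by rewrite sum1dep_card -(row_len_subdiagram (mu_la i)); apply: eq_card => c; rewrite !inE.
Qed.

Section Hooks.
Variables (n : nat) (mu : nat -> nat).
Hypotheses (mu_below : shape_below la mu) (mu_gt0 : (0 < mu n)%N) (mu0 : mu n.+1 = 0%N).

Let dec : decreasing mu. Proof. by case: mu_below. Qed.

Lemma north_steps_hook b : (b <= n)%N -> north_steps (hook la mu b) = (n - b)%N.
Proof.
move=> le_bn; have [c [cn c0]] := exists_subcell mu_below mu_gt0.
apply: succn_inj; rewrite /north_steps row_changes_sorted ?reading_sorted //; last first.
  apply/eqP => r0; have := corner_in_hook mu_gt0 mu0 le_bn cn c0.
  by rewrite -mem_reading r0.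
rewrite -(size_iota b (n - b).+1); apply/eqP.
rewrite -uniq_size_uniq ?undup_uniq ?iota_uniq // => i.
rewrite mem_undup mem_iota addnS subnKC // ltnS.
apply/andP/mapP => [[le_bi le_in]|[a]]; last first.
  rewrite mem_reading => a_h ->; have := a_h; rewrite in_hook => /and3P[-> _ lt_a].
  by split=> //; apply: (crow_le mu_below mu0); rewrite in_subdiagram.
have mui : (0 < mu i)%N by rewrite (leq_trans mu_gt0) // decreasing_leq.
have [|a [ai al]] := @exists_subcell _ _ mu_below i (mu i).-1; first by rewrite prednK.
exists a => //; rewrite mem_reading in_hook ai al le_bi prednK // leqnn andbT.
by rewrite -!subn1 leq_sub2r.
Qed.

Lemma sum_remove_row b : (b <= n)%N ->
  (\sum_(i < n.+1) mu i + b = \sum_(i < n) remove_row mu b i + mu b + n)%N.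
Proof.
have mu_pos i : (i <= n)%N -> (0 < mu i)%N.
  by move=> le_in; rewrite (leq_trans mu_gt0) // decreasing_leq.
elim: n mu_pos => [|k IHk] mu_pos; first by rewrite leqn0 => /eqP->; rewrite big_ord1 big_ord0.
rewrite leq_eqVlt => /predU1P[->|lt_bk].
  rewrite big_ord_recr /=; congr (_ + _ + _)%N.
  by apply: eq_bigr => i _; rewrite /remove_row ltn_ord.
rewrite ltnS in lt_bk; rewrite big_ord_recr /= addnAC IHk // => [|i /leqW/mu_pos //].
rewrite [in RHS]big_ord_recr /= {3}/remove_row ltnNge lt_bk /=.
have := mu_pos _ (leqnn _); case: (mu k.+1) => // m _ /=.
by rewrite !addnS -!addnA; congr (_ + _).+1; rewrite [(m + _)%N]addnC !addnA.
Qed.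

Lemma card_hook b : (b <= n)%N -> #|hook la mu b| = (mu b + n - b)%N.
Proof.
move=> le_bn; rewrite cardsD.
have -> : subdiagram la mu :&: subdiagram la (remove_row mu b) =
    subdiagram la (remove_row mu b).
  by rewrite -subdiagramD_hook // setIDA setIid.
rewrite (@card_subdiagram _ n.+1) // => [|i /(mu_ge mu_below mu0) //].
rewrite (@card_subdiagram _ n) => [||i le_ni]; last first.
- by rewrite /remove_row ltnNge (leq_trans le_bn le_ni) /= (mu_ge mu_below mu0).
- exact: remove_row_below.
by have := sum_remove_row le_bn; lia.
Qed.
End Hooks.

(** Both sides obey one recursion: removing the hook that ends in row [b] matches the cofactor of
    row [b], with sign given by the [n - b] north steps. An empty last row changes neither side. *)
Lemma tiling_sum_jacobi_trudi (A : comNzRingType) (h : nat -> A) n mu :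
  h 0 = 1 -> shape_below la mu -> (forall i, (n <= i)%N -> mu i = 0%N) ->
  tiling_sum (fun r => (-1) ^+ north_steps r * h #|r|) (subdiagram la mu) =
  jacobi_trudi h n mu.
Proof.
move=> h0; elim: n mu => [|n IHn] mu mu_below mu0.
  have -> : subdiagram la mu = set0 by apply/setP=> c; rewrite !inE mu0.
  by rewrite tiling_sum0 /jacobi_trudi det_mx00.
have [mun0|mun_gt0] := posnP (mu n).
  rewrite jacobi_trudi_trailing0 // IHn // => i; rewrite leq_eqVlt => /predU1P[<-//|].
  exact: mu0.
have mun1 : mu n.+1 = 0%N by apply: mu0.
have [dec _] := mu_below.
rewrite (tiling_sum_rec mu_below mun_gt0 mun1) jacobi_trudi_remove_row // => [|i le_in].
  apply: eq_bigr => b _; have le_bn : (b <= n)%N by rewrite -ltnS.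
  rewrite (north_steps_hook mu_below mun_gt0 mun1 le_bn).
  rewrite (card_hook mu_below mun_gt0 mun1 le_bn) IHn //.
    exact: remove_row_below.
  by move=> i le_ni; rewrite /remove_row ltnNge (leq_trans le_bn) //= mu0.
by rewrite (leq_trans mun_gt0) // decreasing_leq.
Qed.
End Reading.

(** * Cancellation of fillings with an ascent in the tail *)

Lemma sorted_rcons_cat (T : Type) (e : rel T) s x y t :
  sorted e (rcons s x ++ y :: t) = [&& sorted e (rcons s x), e x y & sorted e (y :: t)].
Proof. by case: s => [|z s] /=; rewrite ?andbT // cat_path last_rcons. Qed.

Section TailCancellation.
Variables (d : Order.disp_t) (P : finPOrderType d) (la : seq nat).
Variable phi : {ffun cell la -> P}.
Implicit Types (c : cell la) (r : {set cell la}).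

(** The sign of the hook if the entries increase along it, and 0 otherwise; with the filling fixed,
    a tiling thus contributes its sign or 0. *)
Definition filling_weight r : int :=
  (-1) ^+ north_steps r * (sorted <%O [seq phi c | c <- reading r])%:R.

(** What remains after removal of a special rim hook that lies entirely in rows of length 1. *)
Definition first_rows m i := if (i < m)%N then nth 0%N la i else 0%N.

Hypothesis la_dec : decreasing (nth 0%N la).

Lemma first_rows_below m : shape_below la (first_rows m).
Proof.
split=> i; rewrite /first_rows; last by case: ifP.
case: (ltnP i.+1 m) => // lt_im; by rewrite (ltnW lt_im) la_dec.
Qed.

Let W m := tiling_sum filling_weight (subdiagram la (first_rows m)).

Variable (c c' : cell la).
Hypotheses (row_c : crow c = (crow c').+1) (col_c : ccol c = 0%N).
Hypotheses (col_c' : ccol c' = 0%N) (len_c' : nth 0%N la (crow c') = 1%N).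
Hypothesis ascent : (phi c < phi c')%O.

Let q := crow c'.

Let len_ge i : (q <= i)%N -> (nth 0%N la i <= 1)%N.
Proof. by move=> le_qi; rewrite -len_c' decreasing_leq. Qed.

Let len_c : nth 0%N la q.+1 = 1%N.
Proof.
by apply/eqP; rewrite eqn_leq len_ge //= /q -row_c -[X in (X < _)%N]col_c ccol_lt.
Qed.

Let row_q_col (x : cell la) : (q <= crow x)%N -> ccol x = 0%N.
Proof.
move=> le_q; apply/eqP; rewrite -leqn0 -ltnS; apply: leq_trans (ccol_lt x) _.
exact: len_ge.
Qed.

Section Step.
Variable n : nat.
Hypotheses (lt_qn : (q < n)%N) (len_n : (0 < nth 0%N la n)%N).

Let mu := first_rows n.+1.
Let nu := first_rows q.+1.

Let mu_below : shape_below la mu := first_rows_below n.+1.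
Let nu_below : shape_below la nu := first_rows_below q.+1.
Let mu_gt0 : (0 < mu n)%N. Proof. by rewrite /mu /first_rows leqnn. Qed.
Let nu_gt0 : (0 < nu q)%N. Proof. by rewrite /nu /first_rows leqnn len_c'. Qed.
Let mu0 : mu n.+1 = 0%N. Proof. by rewrite /mu /first_rows ltnn. Qed.
Let nu0 : nu q.+1 = 0%N. Proof. by rewrite /nu /first_rows ltnn. Qed.

Let mu_pred i : (q <= i)%N -> (mu i.+1).-1 = 0%N.
Proof.
move=> le_qi; have := len_ge (leqW le_qi); rewrite /mu /first_rows.
by case: ifP => // _; case: (nth _ _ _) => [|[]].
Qed.

Let mu_nu i : (i <= q)%N -> mu i = nu i.
Proof.
move=> le_iq; rewrite /mu /nu /first_rows !ltnS le_iq.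
by rewrite (leq_trans le_iq (ltnW lt_qn)).
Qed.

(** A hook from row [n] to a row [b <= q] passes through [c] and then [c']. Cutting it between them
    leaves a vertical piece ending at [c] and a special rim hook of the first [q.+1] rows. *)
Let hook_split b : (b <= q)%N -> hook la mu b = hook la mu q.+1 :|: hook la nu b.
Proof.
move=> le_bq; apply/setP=> x; rewrite in_setU !in_hook.
have [lt_qx|le_xq] /= := ltnP q (crow x).
  rewrite (leq_trans le_bq (ltnW lt_qx)) /=.
  have -> : nu (crow x) = 0%N by rewrite /nu /first_rows ltnNge lt_qx.
  by rewrite ltn0 !andbF orbF.
congr (_ && (_ && _)); last by rewrite mu_nu.
move: le_xq; rewrite leq_eqVlt => /predU1P[->|lt_xq]; last by rewrite mu_nu.
by rewrite mu_pred // nu0.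
Qed.

Let remove_row_low b : (b <= q)%N ->
  subdiagram la (remove_row mu b) = subdiagram la (remove_row nu b).
Proof.
move=> le_bq; apply/setP=> x; rewrite !in_subdiagram /remove_row.
case: (ltnP (crow x) b) => [lt_xb|_]; first by rewrite mu_nu // (leq_trans (ltnW lt_xb)).
have [lt_xq|le_qx] := ltnP (crow x) q; first by rewrite mu_nu.
have -> : nu (crow x).+1 = 0%N by rewrite /nu /first_rows ltnS ltnNge le_qx.
by rewrite mu_pred.
Qed.

Let remove_row_high b : (q < b)%N -> (b <= n)%N ->
  subdiagram la (remove_row mu b) = subdiagram la (first_rows b).
Proof.
move=> lt_qb le_bn; apply/setP=> x; rewrite !in_subdiagram /remove_row /first_rows.
case: (ltnP (crow x) b) => [lt_xb|le_bx].
  by rewrite /mu /first_rows (leq_trans lt_xb) // leqW.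
by rewrite mu_pred // (leq_trans (ltnW lt_qb)).
Qed.

(** The cut removes one north step, whence the sign. Entries increase along the whole hook exactly
    when they do along both pieces, since [c] ends the first, [c'] starts the second and
    [phi c < phi c']. *)
Let weight_split b : (b <= q)%N ->
  filling_weight (hook la mu b) =
  - (filling_weight (hook la mu q.+1) * filling_weight (hook la nu b)).
Proof.
move=> le_bq; have le_bn : (b <= n)%N by rewrite (leq_trans le_bq) // ltnW.
rewrite /filling_weight (north_steps_hook mu_below mu_gt0 mu0 le_bn).
rewrite (north_steps_hook mu_below mu_gt0 mu0 lt_qn).
rewrite (north_steps_hook nu_below nu_gt0 nu0 le_bq).
have -> : (n - b = (n - q.+1 + (q - b)).+1)%N by lia.
rewrite exprS exprD mulN1r mulNr mulrACA -natrM mulnb; congr (- (_ * _%:R)).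
rewrite hook_split //.
set V := hook la mu q.+1; set K := hook la nu b.
have V_row x : x \in V -> (q < crow x)%N by rewrite in_hook => /andP[].
have K_row x : x \in K -> (crow x <= q)%N.
  by rewrite inE => /andP[_]; apply: (crow_le nu_below nu0).
have c_V : c \in V.
  rewrite in_hook row_c -/q leqnn col_c mu_pred ?leqW //=.
  by rewrite /mu /first_rows ltnS lt_qn len_c.
have c'_K : c' \in K by apply: (corner_in_hook nu_gt0 nu0).
rewrite reading_setU => [|x y /V_row lt_x /K_row le_y]; last first.
  rewrite /sw_ne (leq_ltn_trans le_y lt_x); apply: contraTneq lt_x => ->.
  by rewrite -leqNgt.
have -> : reading V = rcons (reading (V :\ c)) c.
  rewrite -cats1 -reading1 -reading_setU ?[_ :|: [set c]]setUC ?setD1K // => x y.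
  rewrite in_setD1 in_set1 => /andP[neq_xc x_V] /eqP->; rewrite neq_xc andbT /sw_ne.
  rewrite row_c !(row_q_col (x := x)) ?leq0n ?(ltnW (V_row _ _)) //.
  have := V_row _ x_V; rewrite leq_eqVlt andbT orbC eq_sym.
  by rewrite -/q.
have -> : reading K = c' :: reading (K :\ c').
  rewrite -cat1s -reading1 -reading_setU ?setD1K // => x y.
  rewrite in_setD1 in_set1 => /eqP-> /andP[neq_yc y_K]; rewrite eq_sym neq_yc andbT /sw_ne.
  have := K_row _ y_K; rewrite leq_eqVlt => /predU1P[eq_y|->//].
  by case/eqP: neq_yc; apply: cell_inj; rewrite ?row_q_col ?eq_y.
by rewrite map_cat map_rcons /= sorted_rcons_cat ascent.
Qed.

(** In the recursion for [W n.+1], the terms with [b > q.+1] leave [first_rows b] and vanish by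
    assumption. The term [b = q.+1] ends its hook at [c]; expanding what it leaves once more gives
    the split forms of the terms with [b <= q], with opposite sign. *)
Lemma tail_step : (forall b, (q.+1 < b)%N -> (b <= n)%N -> W b = 0) -> W n.+1 = 0.
Proof.
move=> W0; rewrite /W (tiling_sum_rec mu_below mu_gt0 mu0).
rewrite -(big_mkord predT (fun b => filling_weight (hook la mu b) *
  tiling_sum filling_weight (subdiagram la (remove_row mu b)))).
rewrite (big_cat_nat (leq0n q.+1) (leqW lt_qn)) /=.
rewrite (big_ltn (m := q.+1)) // [X in _ + (_ + X)]big1_seq => [|b]; last first.
  rewrite mem_index_iota => /andP[_ /andP[lt_qb le_bn]].
  by rewrite remove_row_high ?(ltnW lt_qb) // -/(W b) W0 ?mulr0.
rewrite addr0 remove_row_high // -/nu (tiling_sum_rec nu_below nu_gt0 nu0).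
rewrite big_mkord mulr_sumr -big_split /= big1 // => b _.
have le_bq : (b <= q)%N by rewrite -ltnS.
by rewrite weight_split // remove_row_low // mulNr -mulrA addNr.
Qed.
End Step.

Lemma tail_ascent_cancel : (forall i, (i < size la)%N -> (0 < nth 0%N la i)%N) ->
  tiling_sum filling_weight [set: cell la] = 0.
Proof.
move=> la_gt0; have -> : [set: cell la] = subdiagram la (first_rows (size la)).
  apply/setP=> x; rewrite in_subdiagram inE /first_rows.
  by rewrite ltn_ord; apply/esym/ccol_lt.
have lt_q : (q.+1 < size la)%N by rewrite /q -row_c ltn_ord.
suff key m : (q.+1 < m <= size la)%N -> W m = 0 by apply: key; rewrite lt_q leqnn.
have [k] := ubnP m; elim: k m => // k IHk [//|n] le_nk /andP[lt_qn le_n].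
apply: tail_step => // [|b lt_qb le_bn]; first exact: la_gt0.
by apply: IHk; [exact: leq_ltn_trans le_bn le_nk|rewrite lt_qb (leq_trans le_bn) // ltnW].
Qed.
End TailCancellation.

(** * Fillings and the tail condition *)

Lemma is_part_gt0 la i : is_part la -> (i < size la)%N -> (0 < nth 0%N la i)%N.
Proof.
case/andP=> _ la0 lt_i; rewrite lt0n; apply: contra la0 => /eqP <-.
exact: mem_nth.
Qed.

Lemma is_part_decreasing la : is_part la -> decreasing (nth 0%N la).
Proof.
case/andP=> /(sortedP 0%N) la_sorted _ i.
case: (ltnP i.+1 (size la)) => [/la_sorted //|le_i].
by rewrite nth_default.
Qed.

Lemma lt_sorted_comparable (d : Order.disp_t) (T : porderType d) (s : seq T) :
  sorted <%O s -> {in s &, forall x y, (x >=< y)%O}.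
Proof.
move=> s_sorted x y x_s y_s; have := s_sorted; rewrite lt_sorted_uniq_le => /andP[_ le_s].
have := x_s; have := y_s; rewrite -!index_mem => lt_y lt_x.
rewrite -(nth_index x x_s) -(nth_index x y_s) /Order.comparable.
case/orP: (leq_total (index x s) (index y s)) => le_i.
  by rewrite (le_sorted_leq_nth x le_s).
by rewrite orbC (le_sorted_leq_nth x le_s).
Qed.

Section Fillings.
Variables (d : Order.disp_t) (P : finPOrderType d) (la : seq nat).
Hypothesis la_part : is_part la.
Implicit Types (phi : {ffun cell la -> P}) (t : {set {set cell la}}).

Definition bijective_filling phi := [forall v : P, #|[set c | phi c == v]| == 1%N].

Lemma bijective_filling_inj phi : bijective_filling phi -> injective phi.
Proof.
move/forallP=> bij a b eq_ab; have /cards1P[c /setP Dc] := bij (phi a).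
have := Dc a; have := Dc b; rewrite !inE eq_ab eqxx.
by move=> /esym/eqP-> /esym/eqP->.
Qed.

(** Failure of the tail condition gives consecutive tail cells with [phi c <= phi c'], strict by
    injectivity. Their rows are consecutive: a row between two rows of length 1 has length 1 as
    well, and its cell would come between them in the reading. *)
Lemma tail_ascent t phi : injective phi -> ~~ non_increasing (tail_sequence (t, phi)) ->
  exists c c', [/\ crow c = (crow c').+1, ccol c = 0%N, ccol c' = 0%N,
    nth 0%N la (crow c') = 1%N & (phi c < phi c')%O].
Proof.
move=> phi_inj; rewrite /non_increasing /tail_sequence /=.
set tail := [set c | _]; have [c0|] := pickP (mem tail); last first.
  by move=> no; have -> : reading tail = [::]
    by apply/eqP; rewrite -size_eq0 size_reading; apply/eqP/eq_card0.
move=> _ not_sorted.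
have [k [lt_k le_phi]] : exists k, (k.+1 < size (reading tail))%N /\
    (phi (nth c0 (reading tail) k) <= phi (nth c0 (reading tail) k.+1))%O.
  pose e := [rel a b : cell la | ~~ (phi a <= phi b)%O].
  move: not_sorted; rewrite sorted_map -[sorted _ _]/(sorted e _).
  have [/hasP[k]|/hasPn no] := boolP (has (fun k => ~~ e (nth c0 (reading tail) k)
      (nth c0 (reading tail) k.+1)) (iota 0 (size (reading tail)).-1)).
    rewrite mem_iota /= negbK => lt_k le_k _; exists k; split=> //.
    by rewrite -ltn_predRL.
  case/negP; apply/(sortedP c0) => i lt_i; rewrite -[X in is_true X]negbK; apply: no.
  by rewrite mem_iota add0n ltn_predRL.
set c := nth c0 _ k in le_phi; set c' := nth c0 _ k.+1 in le_phi.
have tail_row x : x \in tail -> nth 0%N la (crow x) = 1%N by rewrite inE => /eqP.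
have tail_col x : x \in tail -> ccol x = 0%N.
  by move=> x_t; have := ccol_lt x; rewrite (tail_row _ x_t); case: (ccol x).
have c_t : c \in tail by rewrite -mem_reading mem_nth // ltnW.
have c'_t : c' \in tail by rewrite -mem_reading mem_nth.
have neq_cc' : c != c'.
  by rewrite /c /c' (nth_uniq _ (ltnW lt_k) lt_k (reading_uniq _)) ltn_eqF.
have row_lt : (crow c' < crow c)%N.
  have /(sortedP c0)/(_ k lt_k) := reading_sorted tail.
  rewrite -/c -/c' /sw_ne => /orP[//|/andP[/eqP eq_r _]].
  by case/eqP: neq_cc'; apply: cell_inj; rewrite ?tail_col.
exists c, c'; split; rewrite ?tail_col ?tail_row //; last first.
  by rewrite lt_neqAle le_phi andbT (inj_eq phi_inj).
apply/eqP; rewrite eqn_leq row_lt andbT leqNgt; apply/negP => lt_row.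
have len1 : nth 0%N la (crow c').+1 = 1%N.
  have := is_part_decreasing la_part (crow c').
  have := decreasing_leq (is_part_decreasing la_part) (ltnW lt_row).
  rewrite !tail_row //; lia.
have [|x [xr xl]] := @exists_cell la (crow c').+1 0; first by rewrite len1.
have x_t : x \in tail by rewrite inE xr len1.
have := x_t; rewrite -mem_reading => /(nthP c0)[j lt_j xE].
have [le_jk|lt_kj] := leqP j k.
  have := sorted_leq_nth (@sw_ne_trans la) _ c0 (reading_sorted tail).
  move/(_ (fun a => ltac:(by rewrite /sw_ne eqxx leqnn orbT)) j k lt_j (ltnW lt_k) le_jk).
  rewrite xE -/c /sw_ne !tail_col // xr leqnn andbT ltnNge (ltnW lt_row) /=.
  by rewrite ltn_eqF.
have := sorted_leq_nth (@sw_ne_trans la) _ c0 (reading_sorted tail).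
move/(_ (fun a => ltac:(by rewrite /sw_ne eqxx leqnn orbT)) k.+1 j lt_k lt_j lt_kj).
by rewrite xE -/c' /sw_ne xr !tail_col // leqnn andbT ltnNge leqnSn ltn_eqF.
Qed.

Lemma tail_filling_cancel t phi : bijective_filling phi ->
  ~~ non_increasing (tail_sequence (t, phi)) ->
  tiling_sum (filling_weight phi) [set: cell la] = 0.
Proof.
move/bijective_filling_inj => phi_inj /(tail_ascent phi_inj)[c [c' [rc cc cc' len asc]]].
apply: (tail_ascent_cancel _ rc cc cc' len asc) => [|i]; first exact: is_part_decreasing.
exact: is_part_gt0.
Qed.

Lemma prod_filling_weight t phi :
  \prod_(r in t) filling_weight phi r =
  tabloid_sign t * [forall r in t, sorted <%O [seq phi c | c <- reading r]]%:R.
Proof.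
rewrite big_split /= /tabloid_sign -expr_sum; congr (_ * _).
case: forall_inP => [sorted_t|/forall_inP/forall_inPn[r r_t not_sorted]].
  by rewrite big1 // => r /sorted_t->.
by rewrite (bigD1 r) //= (negPf not_sorted) mul0r.
Qed.

Lemma sorted_lt_stable t phi :
  [forall r in t, sorted <%O [seq phi c | c <- reading r]] ->
  [forall r in t, forall a in r, forall b in r, ~~ inc (phi a) (phi b)].
Proof.
move/forall_inP=> sorted_t; apply/forall_inP => r r_t.
apply/forall_inP => a a_r; apply/forall_inP => b b_r.
rewrite /inc /= negbK; apply: (lt_sorted_comparable (sorted_t r r_t));
  by rewrite map_f // mem_reading.
Qed.

Lemma sum_tail_g_tabloids :
  \sum_(T in tail_g_tabloids P la) g_tabloid_sign T =
  \sum_(phi : {ffun cell la -> P} | bijective_filling phi)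
     tiling_sum (filling_weight phi) [set: cell la].
Proof.
rewrite big_mkcond (eq_bigr (fun T => if (T.1, T.2) \in tail_g_tabloids P la
  then tabloid_sign T.1 else 0)); last by case.
rewrite -(pair_bigA _ (fun t phi => if (t, phi) \in tail_g_tabloids P la
  then tabloid_sign t else 0)) exchange_big /= [RHS]big_mkcond.
apply: eq_bigr => phi _.
(* Any tiling may accompany [phi] in [tail_sequence]; [set0] is taken. *)
have in_tail t : (t, phi) \in tail_g_tabloids P la =
    [&& non_increasing (tail_sequence (set0, phi)), bijective_filling phi,
     special_tiling [set: cell la] t &
     [forall r in t, sorted <%O [seq phi c | c <- reading r]]].
  rewrite inE /is_srh_g_tabloid /= -/(bijective_filling phi).
  rewrite -[is_srh_tabloid t]/(special_tiling setT t) andbC; congr (_ && _).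
  rewrite andbCA; congr (_ && (_ && _)); rewrite andb_idl //.
  exact: sorted_lt_stable.
case: ifP => [bij|not_bij]; last first.
  by rewrite big1 // => t _; rewrite in_tail not_bij andbF.
have [tail_ok|not_ok] := boolP (non_increasing (tail_sequence (set0, phi))); last first.
  rewrite (tail_filling_cancel bij not_ok) big1 // => t _.
  by rewrite in_tail (negPf not_ok).
rewrite /tiling_sum [RHS]big_mkcond; apply: eq_bigr => t _.
rewrite in_tail tail_ok bij /= prod_filling_weight.
by case: special_tiling; case: forallP; rewrite ?mulr1 ?mulr0.
Qed.
End Fillings.

(** * Generating series of chains *)

Section ChainSums.
Variables (d : Order.disp_t) (P : finPOrderType d).

Definition chain (C : {set P}) := [forall a in C, forall b in C, (a >=< b)%O].

Definition set_mnm (C : {set P}) : 'X_{1..#|P|} := [multinom (enum_val i \in C : nat) | i < #|P|].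

Definition chain_sum m : {mpoly int[#|P|]} :=
  \sum_(C : {set P} | chain C && (#|C| == m)) 'X_[set_mnm C].

Definition full_coef (p : {mpoly int[#|P|]}) : int := p@_(set_mnm [set: P]).

Lemma chain_sum0 : chain_sum 0 = 1.
Proof.
rewrite /chain_sum (big_pred1 set0) => [|C /=].
  rewrite -mpolyX0; congr 'X_[_]; apply/mnmP => i; by rewrite !mnmE inE.
rewrite cards_eq0 andb_idl // => /eqP->.
by apply/forall_inP => a; rewrite inE.
Qed.

Lemma chain_sum_large m : (#|P| < m)%N -> chain_sum m = 0.
Proof.
move=> lt_m; rewrite /chain_sum big1 // => C /andP[_ /eqP Cm].
by have := max_card (mem C); rewrite Cm leqNgt lt_m.
Qed.

(** Chains are the stable sets of [inc], so these are its proper colorings with [a i] vertices of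
    color [i]. They serve twice: for the monomials of the chromatic symmetric function, and for
    fillings, the blocks of a tiling being the colors. *)
Definition chain_colorings (I : finType) (a : I -> nat) : {set {ffun P -> I}} :=
  [set f : {ffun P -> I} |
    [forall i, chain [set v | f v == i] && (#|[set v | f v == i]| == a i)]].

(** Expanding the product chooses a chain [F i] of size [a i] for each [i]. Their monomials multiply
    to the product of all variables exactly when each vertex lies in one [F i], that is, when the
    [F i] are the fibers of a map to [I]. *)
Lemma full_coef_prod_chain_sum (I : finType) (a : I -> nat) :
  full_coef (\prod_i chain_sum (a i)) = #|chain_colorings a|%:R.
Proof.
rewrite /full_coef /chain_sum bigA_distr_big_dep raddf_sum /=.
pose fibers (f : {ffun P -> I}) := [ffun i => [set v | f v == i]].
have fibers_inj : injective fibers.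
  move=> f f' /ffunP eq_f; apply/ffunP => v; have := eq_f (f v).
  by rewrite !ffunE => /setP/(_ v); rewrite !inE eqxx => /esym/eqP.
have full_partition (F : {ffun I -> {set P}}) :
    (\sum_i set_mnm (F i) == set_mnm [set: P])%MM =
    [forall v, #|[set i | v \in F i]| == 1%N].
  have sumE v : #|[set i | v \in F i]| = (\sum_i set_mnm (F i))%MM (enum_rank v).
    rewrite mnm_sumE -sum1dep_card big_mkcond /=; apply: eq_bigr => i _.
    by rewrite mnmE enum_rankK; case: (v \in F i).
  apply/eqP/forallP => [/mnmP eq_mnm v|one].
    by rewrite sumE eq_mnm mnmE inE.
  apply/mnmP => i; rewrite -(enum_valK i) -sumE (eqP (one _)).
  by rewrite mnmE inE.
rewrite -(card_imset _ fibers_inj) -sum1_card natr_sum [LHS]big_mkcond [RHS]big_mkcond /=.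
apply: eq_bigr => F _; rewrite mprodXE mcoeffX full_partition.
suff -> : (F \in fibers @: chain_colorings a) =
    (F \in family (fun i => [pred C : {set P} | chain C && (#|C| == a i)])) &&
    [forall v, #|[set i | v \in F i]| == 1%N].
  by case: (F \in _); case: forallP.
apply/imsetP/andP => [[f f_a ->]|[/familyP F_chain /forallP one]].
  split; last first.
    apply/forallP => v; apply/cards1P; exists (f v); apply/setP => i.
    by rewrite !inE ffunE inE eq_sym.
  apply/familyP => i; rewrite ffunE inE; move: f_a; rewrite inE => /forallP/(_ i) //.
have /fin_all_exists[f f_F] v : exists i, [set i | v \in F i] = [set i].
  exact/cards1P.
have memF v i : (v \in F i) = (f v == i).
  by have /setP/(_ i) := f_F v; rewrite !inE eq_sym.
have FE i : F i = [set v | [ffun v => f v] v == i].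
  by apply/setP => v; rewrite inE ffunE memF.
exists [ffun v => f v]; last by apply/ffunP => i; rewrite ffunE FE.
rewrite inE; apply/forallP => i; rewrite -FE; exact: F_chain.
Qed.
End ChainSums.
Arguments chain_colorings {d P I} a.

Lemma uniq_map_inj (T1 T2 : eqType) (f : T1 -> T2) s :
  uniq (map f s) -> {in s &, injective f}.
Proof.
elim: s => //= z s IHs /andP[fz_s uniq_fs] x y; rewrite !inE.
case/predU1P=> [->|x_s] /predU1P[->|y_s] // eq_f; last exact: IHs.
  by move: fz_s; rewrite eq_f map_f.
by move: fz_s; rewrite -eq_f map_f.
Qed.

(** * Increasing fillings as colorings by the blocks of a tiling *)

Section CountFillings.
Variables (d : Order.disp_t) (P : finPOrderType d) (la : seq nat).
Implicit Types (phi : {ffun cell la -> P}) (t : {set {set cell la}}).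

Lemma chain_sort_lt (S : {set P}) : chain S -> sorted <%O (sort <=%O (enum S)).
Proof.
move/forall_inP=> chainS; rewrite lt_sorted_uniq_le sort_uniq enum_uniq /=.
apply: (@sort_sorted_in _ (mem S)); last by apply/allP => v; rewrite mem_enum.
by move=> a b a_S b_S; apply: (forall_inP (chainS a a_S)).
Qed.

Variable t : {set {set cell la}}.
Hypothesis part_t : partition t [set: cell la].

Let block_mem c : pblock t c \in t.
Proof. by apply: pblock_mem; rewrite (cover_partition part_t) inE. Qed.

Let mem_block c : c \in pblock t c.
Proof. by rewrite mem_pblock (cover_partition part_t) inE. Qed.

Let blockE r c : r \in t -> c \in r -> pblock t c = r.
Proof. exact/def_pblock/partition_trivIset/part_t. Qed.

Definition increasing_fillings := [set phi : {ffun cell la -> P} |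
  bijective_filling phi && [forall r in t, sorted <%O [seq phi c | c <- reading r]]].

(** Each vertex gets the block of its cell as color; for a bijective filling the default [set0] is
    not reached. *)
Definition block_coloring phi : {ffun P -> {set cell la}} :=
  [ffun v => odflt set0 (omap (pblock t) [pick c | phi c == v])].

(** Size 0 outside [t] keeps all colors within [t]. *)
Definition block_size (r : {set cell la}) := if r \in t then #|r| else 0%N.

Let bij_onto phi v : bijective_filling phi -> exists c, phi c = v.
Proof.
move/forallP/(_ v)/cards1P => [c /setP/(_ c)]; rewrite !inE eqxx => /eqP <-.
by exists c.
Qed.

Lemma block_coloringE phi c :
  bijective_filling phi -> block_coloring phi (phi c) = pblock t c.
Proof.
move=> bij; rewrite ffunE; case: pickP => [c' /eqP|/(_ c)]; last by rewrite eqxx.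
by move/(bijective_filling_inj bij) => ->.
Qed.

Lemma fiber_block_coloring phi r : bijective_filling phi -> r \in t ->
  [set v | block_coloring phi v == r] = phi @: r.
Proof.
move=> bij r_t; apply/setP => v; have [c <-] := bij_onto v bij.
rewrite inE block_coloringE // (mem_imset _ _ (bijective_filling_inj bij)).
by apply/eqP/idP => [<-|/(blockE r_t)//].
Qed.

(** The entries along a block are the increasing enumeration of its color class. *)
Lemma block_coloring_inj : {in increasing_fillings &, injective block_coloring}.
Proof.
move=> phi psi; rewrite !inE => /andP[bij_phi /forall_inP inc_phi].
move=> /andP[bij_psi /forall_inP inc_psi] eq_col; apply/ffunP => c.
pose r := pblock t c; have r_t : r \in t by apply: block_mem.
suff /eq_in_map eq_map : [seq phi c | c <- reading r] = [seq psi c | c <- reading r].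
  by apply: eq_map; rewrite mem_reading mem_block.
apply: lt_sorted_eq; [exact: inc_phi | exact: inc_psi |] => v.
have /setP/(_ v) : phi @: r = psi @: r by rewrite -!fiber_block_coloring // eq_col.
have im f : (v \in [seq f c | c <- reading r]) = (v \in f @: r).
  by apply/mapP/imsetP => -[x x_r ->]; exists x; rewrite ?mem_reading // -mem_reading.
by rewrite !im.
Qed.

(** A color class is a chain with as many elements as its block has cells, so its increasing
    enumeration can be placed along the reading of the block. *)
Lemma block_coloring_onto (C : {ffun P -> {set cell la}}) :
  C \in chain_colorings block_size ->
  exists2 phi, phi \in increasing_fillings & C = block_coloring phi.
Proof.
rewrite inE => /forallP C_chain.
pose S r := sort <=%O (enum [set v | C v == r]).
have mem_S r v : (v \in S r) = (C v == r) by rewrite mem_sort mem_enum inE.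
have S_uniq r : uniq (S r) by rewrite sort_uniq enum_uniq.
have size_S r : r \in t -> size (S r) = #|r|.
  move=> r_t; rewrite size_sort -cardE; have /andP[_ /eqP->] := C_chain r.
  by rewrite /block_size r_t.
have S_sorted r : sorted <%O (S r).
  by apply: chain_sort_lt; have /andP[] := C_chain r.
have C_t v : C v \in t.
  have /andP[_] := C_chain (C v); rewrite /block_size; case: ifP => // _.
  by rewrite cards_eq0 => /eqP/setP/(_ v); rewrite !inE eqxx.
(* [P] has no distinguished element; a vertex of the color class serves as default value of
   [nth]. *)
have ex_v c : exists v, C v == pblock t c.
  have: (0 < size (S (pblock t c)))%N.
    by rewrite size_S ?block_mem //; apply/card_gt0P; exists c.
  case E: (S _) => [|v s] // _; exists v; by rewrite -mem_S E mem_head.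
pose phi := [ffun c => nth (xchoose (ex_v c)) (S (pblock t c)) (index c (reading (pblock t c)))].
have map_phi r : r \in t -> [seq phi c | c <- reading r] = S r.
  move=> r_t; have [c0 c0_r] : exists c, c \in r by apply/set0Pn/(partition_neq0 part_t r_t).
  apply: (@eq_from_nth _ (phi c0)); first by rewrite size_map size_reading size_S.
  move=> i; rewrite size_map => lt_i; rewrite (nth_map c0) // ffunE.
  have in_r : nth c0 (reading r) i \in r by rewrite -mem_reading mem_nth.
  move: (xchoose _) => v0; rewrite (blockE r_t in_r) index_uniq ?reading_uniq //.
  by apply: set_nth_default; rewrite size_S // -size_reading.
have C_phi c : C (phi c) = pblock t c.
  apply/eqP; rewrite -mem_S -map_phi ?block_mem // map_f // mem_reading.
  exact: mem_block.
have phi_inj : injective phi.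
  move=> a b eq_ab; have eq_r : pblock t a = pblock t b by rewrite -!C_phi eq_ab.
  have := S_uniq (pblock t b); rewrite -map_phi ?block_mem //.
  move/uniq_map_inj => inj; apply: inj; rewrite ?mem_reading ?mem_block //.
  by rewrite -eq_r mem_block.
have phi_onto v : exists2 c, c \in C v & phi c = v.
  have : v \in S (C v) by rewrite mem_S.
  by rewrite -map_phi // => /mapP[c]; rewrite mem_reading => c_v vE; exists c.
have bij : bijective_filling phi.
  apply/forallP => v; apply/cards1P; have [c _ <-] := phi_onto v; exists c.
  by apply/setP => c'; rewrite !inE (inj_eq phi_inj).
exists phi; first by rewrite inE bij; apply/forall_inP => r r_t; rewrite map_phi // S_sorted.
apply/ffunP => v; have [c _ <-] := phi_onto v.
by rewrite block_coloringE.
Qed.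

Lemma card_increasing_fillings :
  #|increasing_fillings| = #|chain_colorings (P := P) block_size|.
Proof.
rewrite -(card_in_imset block_coloring_inj); apply: eq_card => C.
apply/imsetP/idP => [[phi phi_inc ->]|/block_coloring_onto[phi phi_inc ->]]; last by exists phi.
move: phi_inc; rewrite !inE => /andP[bij /forall_inP inc_phi].
apply/forallP => r; rewrite /block_size; case: ifPn => [r_t|r_nt].
  rewrite fiber_block_coloring // card_imset ?eqxx ?andbT; last exact: bijective_filling_inj.
  apply/forall_inP => _ /imsetP[a a_r ->]; apply/forall_inP => _ /imsetP[b b_r ->].
  by apply: (lt_sorted_comparable (inc_phi r r_t)); rewrite map_f // mem_reading.
have -> : [set v | block_coloring phi v == r] = set0.
  apply/setP => v; have [c <-] := bij_onto v bij; rewrite !inE block_coloringE //.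
  by apply: contraNF r_nt => /eqP <-.
by rewrite cards0 eqxx andbT; apply/forall_inP => a; rewrite inE.
Qed.

Lemma full_coef_prod_blocks :
  full_coef (\prod_(r in t) chain_sum P #|r|) = #|increasing_fillings|%:R.
Proof.
rewrite card_increasing_fillings -full_coef_prod_chain_sum; congr full_coef.
rewrite big_mkcond; apply: eq_bigr => r _; rewrite /block_size.
by case: ifP => // _; rewrite chain_sum0.
Qed.
End CountFillings.

(** * From signed tabloids to the determinant of chain sums *)

Section SignedCount.
Variables (d : Order.disp_t) (P : finPOrderType d) (la : seq nat).
Hypothesis la_part : is_part la.

Lemma special_tiling_partition (t : {set {set cell la}}) D :
  special_tiling D t -> partition t D.
Proof. by case/special_tilingP => s [/strips_off_partition part_s -> _]. Qed.

Lemma sum_tail_g_tabloids_jacobi_trudi :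
  \sum_(T in tail_g_tabloids P la) g_tabloid_sign T =
  full_coef (jacobi_trudi (chain_sum P) (size la) (nth 0%N la)).
Proof.
have la_below : shape_below la (nth 0%N la).
  by split=> //; apply: is_part_decreasing.
rewrite sum_tail_g_tabloids //.
rewrite -(tiling_sum_jacobi_trudi (chain_sum0 P) la_below) => [|i]; last exact: nth_default.
have -> : subdiagram la (nth 0%N la) = [set: cell la].
  by apply/setP=> c; rewrite in_subdiagram inE ccol_lt.
rewrite /tiling_sum exchange_big /full_coef raddf_sum /=; apply: eq_bigr => t till_t.
rewrite big_split /= -expr_sum -signr_odd mulr_sign.
transitivity (tabloid_sign t * #|increasing_fillings P t|%:R).
  rewrite -sum1_card natr_sum mulr_sumr [RHS]big_mkcond [LHS]big_mkcond.
  apply: eq_bigr => phi _; rewrite prod_filling_weight inE.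
  by case: bijective_filling; case: forallP; rewrite ?mulr1 ?mulr0.
rewrite -full_coef_prod_blocks ?special_tiling_partition // /tabloid_sign -signr_odd mulr_sign.
by case: odd; rewrite ?raddfN.
Qed.
End SignedCount.

(** * Semistandard tableaux *)

Section PartialTableaux.
Variables (la : seq nat) (alpha : nat -> nat) (N : nat).
Hypothesis la_dec : decreasing (nth 0%N la).
Implicit Types (T : {ffun cell la -> 'I_N.+1}) (a b c : cell la) (mu nu : nat -> nat).

Lemma order_ideal_subdiagram (D : {set cell la}) :
  (forall a b, b \in D -> (crow a <= crow b)%N -> (ccol a <= ccol b)%N -> a \in D) ->
  exists2 mu, shape_below la mu & D = subdiagram la mu.
Proof.
move=> ideal; exists (fun i => \max_(c in D | crow c == i) (ccol c).+1)%N.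
  split=> i; apply/bigmax_leqP => c /andP[c_D /eqP ci]; last by rewrite -ci ccol_lt.
  have lt_c : (ccol c < nth 0%N la i)%N.
    by apply: leq_trans (la_dec i); rewrite -ci ccol_lt.
  have [a [ai al]] := exists_cell lt_c; rewrite -al.
  apply: (leq_bigmax_cond (F := fun c => (ccol c).+1)).
  by rewrite ai eqxx andbT (ideal a c) ?al ?ai ?ci.
apply/setP=> c; rewrite in_subdiagram; apply/idP/idP => [c_D|].
  by apply: (leq_bigmax_cond (F := fun c => (ccol c).+1)); rewrite c_D eqxx.
case: (pickP (fun a => (a \in D) && (crow a == crow c))) => [a0 a0P|no].
  rewrite (bigop.bigmax_eq_arg a0) //; case: arg_maxnP => // a /andP[a_D /eqP ac] _ le_a.
  by apply: ideal a_D _ _; rewrite ?ac.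
by rewrite big_pred0.
Qed.

Lemma subdiagram_leq mu nu : (forall i, (mu i <= nth 0%N la i)%N) ->
  subdiagram la mu \subset subdiagram la nu -> forall i, (mu i <= nu i)%N.
Proof.
move=> mu_la /subsetP sub i; rewrite leqNgt; apply/negP => lt_i.
have [c [ci cl]] := exists_cell (leq_trans lt_i (mu_la i)).
by have := sub c; rewrite !in_subdiagram ci cl lt_i ltnn => /(_ isT).
Qed.

(* A tableau of shape [subdiagram la mu] with entries below [n], extended by the
   constant [N] to the cells outside of its shape. *)
Definition partial_tableau n mu T : bool :=
  [&& [forall c, if c \in subdiagram la mu then (T c < n)%N else T c == N :> nat],
      [forall a, forall b, (b \in subdiagram la mu) ==>
        ((crow a == crow b) && (ccol a <= ccol b)%N ==> (T a <= T b)%N) &&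
        ((ccol a == ccol b) && (crow a < crow b)%N ==> (T a < T b)%N)] &
      [forall k : 'I_N.+1, (k < n)%N ==> (#|[set c | T c == k]| == alpha k)]].

Lemma partial_tableauP n mu T : reflect
  [/\ forall c, c \in subdiagram la mu -> (T c < n)%N,
      forall c, c \notin subdiagram la mu -> T c = N :> nat,
      forall a b, b \in subdiagram la mu -> crow a = crow b -> (ccol a <= ccol b)%N ->
        (T a <= T b)%N,
      forall a b, b \in subdiagram la mu -> ccol a = ccol b -> (crow a < crow b)%N ->
        (T a < T b)%N &
      forall k : 'I_N.+1, (k < n)%N -> #|[set c | T c == k]| = alpha k]
  (partial_tableau n mu T).
Proof.
apply: (iffP and3P) => [[/forallP H1 /forallP H2 /forallP H3]|[H1 H2 H3 H4 H5]].
  split=> [c c_mu|c c_mu|a b b_mu eq_r le_c|a b b_mu eq_c lt_r|k lt_k].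
  - by have := H1 c; rewrite c_mu.
  - by have := H1 c; rewrite (negPf c_mu) => /eqP.
  - have /forallP/(_ b) := H2 a; rewrite b_mu => /andP[/implyP H _].
    by apply: H; rewrite eq_r eqxx.
  - have /forallP/(_ b) := H2 a; rewrite b_mu => /andP[_ /implyP H].
    by apply: H; rewrite eq_c eqxx.
  - by have /implyP/(_ lt_k)/eqP := H3 k.
split.
- by apply/forallP => c; case: ifPn => [/H1|/H2 ->].
- apply/forallP => a; apply/forallP => b; apply/implyP => b_mu; apply/andP; split.
    by apply/implyP => /andP[/eqP eq_r]; apply: H3.
  by apply/implyP => /andP[/eqP eq_c]; apply: H4.
- by apply/forallP => k; apply/implyP => /H5->.
Qed.

Lemma subdiagram_ideal mu a b : decreasing mu -> b \in subdiagram la mu ->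
  (crow a <= crow b)%N -> (ccol a <= ccol b)%N -> a \in subdiagram la mu.
Proof.
move=> dec; rewrite !in_subdiagram => lt_b le_r le_c.
by apply: leq_ltn_trans le_c _; apply: leq_trans lt_b _; apply: decreasing_leq.
Qed.

(** Entries increase strictly down a column. Consequently the cells with entry below [n] lie in the
    first [n] rows. *)
Lemma partial_tableau_crow n mu T c : decreasing mu -> partial_tableau n mu T ->
  c \in subdiagram la mu -> (crow c <= T c)%N.
Proof.
move=> dec /partial_tableauP[_ _ _ col _].
have [k] := ubnP (crow c); elim: k c => // k IHk c le_k c_mu.
case E: (crow c) => [//|i].
have [a [ai al]] : exists a, crow a = i /\ ccol a = ccol c.
  by apply: exists_cell; apply: leq_trans (ccol_lt c) _; rewrite E.
have a_mu : a \in subdiagram la mu.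
  by apply: subdiagram_ideal dec c_mu _ _; rewrite ?al // ai E.
have lt_ac : (crow a < crow c)%N by rewrite ai E.
rewrite -ai; apply: leq_ltn_trans (IHk a _ a_mu) (col a c c_mu al lt_ac).
exact: leq_trans lt_ac _.
Qed.

Section Step.
Variables (n : nat) (mu : nat -> nat) (B : nat).
Hypotheses (lt_nN : (n < N)%N) (mu_below : shape_below la mu).
Hypotheses (mu0 : forall i, (n < i)%N -> mu i = 0%N) (muB : (mu 0 < B)%N).

Let dec : decreasing mu. Proof. by case: mu_below. Qed.

Let strip_of (nu : {ffun 'I_n -> 'I_B}) :=
  horizontal_strip n mu (extend0 nu) &&
  (\sum_(i < n.+1) mu i == \sum_i nu i + alpha n)%N.

Let inner T (nu : {ffun 'I_n -> 'I_B}) :=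
  [forall c, (T c < n)%N == (c \in subdiagram la (extend0 nu))].

Lemma strip_leq (nu : {ffun 'I_n -> 'I_B}) i :
  horizontal_strip n mu (extend0 nu) -> (extend0 nu i <= mu i)%N.
Proof.
move=> /forallP strip; have [le_ni|lt_in] := leqP n i; first by rewrite extend0_ge.
by have /andP[] := strip (Ordinal (ltnW lt_in : i < n.+1)%N).
Qed.

Lemma strip_geq (nu : {ffun 'I_n -> 'I_B}) i :
  horizontal_strip n mu (extend0 nu) -> (mu i.+1 <= extend0 nu i)%N.
Proof.
move=> /forallP strip; have [le_ni|lt_in] := leqP n i; first by rewrite mu0.
by have /andP[_] := strip (Ordinal (lt_in : i.+1 < n.+1)%N).
Qed.

Lemma strip_below (nu : {ffun 'I_n -> 'I_B}) :
  horizontal_strip n mu (extend0 nu) -> shape_below la (extend0 nu).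
Proof.
move=> strip; have [_ mu_la] := mu_below; split=> i.
  exact: leq_trans (strip_leq _ strip) (strip_geq _ strip).
exact: leq_trans (strip_leq _ strip) (mu_la i).
Qed.

Lemma sum_extend0 (nu : {ffun 'I_n -> 'I_B}) : (\sum_(i < n) extend0 nu i = \sum_i nu i)%N.
Proof. by apply: eq_bigr => i _; rewrite extend0_ord. Qed.

(** The shape in question consists of the cells with entry below [n]. The remaining cells of [mu]
    carry the entry [n] and form a horizontal strip, as no two of them share a column. *)
Lemma inner_unique T : partial_tableau n.+1 mu T ->
  exists rho0, forall rho, (strip_of rho && inner T rho) = (rho == rho0).
Proof.
move=> tabT; have [T_in T_out T_row T_col T_cont] := partial_tableauP _ _ _ tabT.
have lt_in c : (T c < n)%N -> c \in subdiagram la mu.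
  by apply: contraLR => /T_out->; rewrite -leqNgt ltnW.
have [nu [nu_dec nu_la] nuE] : exists2 nu, shape_below la nu &
    [set c | (T c < n)%N] = subdiagram la nu.
  apply: order_ideal_subdiagram => a b; rewrite !inE => lt_b le_r le_c.
  (* [x] lies in the row of [b] and the column of [a]; entries are compared from [a] down to [x],
     then right to [b]. *)
  have [x [xr xl]] := exists_cell (leq_ltn_trans le_c (ccol_lt b)).
  have le_x : (T x <= T b)%N by apply: T_row; rewrite ?xl ?lt_in.
  have b_mu := lt_in b lt_b; apply: leq_ltn_trans lt_b; apply: leq_trans le_x.
  move: le_r; rewrite leq_eqVlt => /predU1P[eq_r|lt_r].
    by rewrite (_ : a = x) //; apply: cell_inj; rewrite ?xr ?xl.
  apply/ltnW/T_col; rewrite ?xr ?xl //.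
  by apply: (subdiagram_ideal dec b_mu); rewrite ?xr ?xl.
have nu_mem c : (c \in subdiagram la nu) = (T c < n)%N by rewrite -nuE inE.
have nu_le i : (nu i <= mu i)%N.
  apply: subdiagram_leq => //; apply/subsetP=> c; rewrite nu_mem; exact: lt_in.
have nu0 i : (n <= i)%N -> nu i = 0%N.
  move=> le_ni; apply/eqP; rewrite -leqn0 leqNgt; apply/negP => nu_gt0.
  have [c [ci cl]] := exists_cell (leq_trans nu_gt0 (nu_la i)).
  have : c \in subdiagram la nu by rewrite in_subdiagram ci cl.
  rewrite nu_mem => lt_c; have := partial_tableau_crow dec tabT (lt_in c lt_c).
  by rewrite leqNgt ci (leq_trans lt_c).
have nuB i : (nu i < B)%N.
  by apply: leq_ltn_trans muB; apply: leq_trans (nu_le i) _; apply: decreasing_leq.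
pose nu' : {ffun 'I_n -> 'I_B} := [ffun i : 'I_n => Ordinal (nuB i)].
have nu'E i : extend0 nu' i = nu i.
  have [le_ni|lt_in'] := leqP n i; first by rewrite extend0_ge ?nu0.
  by rewrite -[i]/(nat_of_ord (Ordinal lt_in')) extend0_ord ffunE.
have sub_nu' : subdiagram la (extend0 nu') = subdiagram la nu.
  by apply/setP=> c; rewrite !in_subdiagram nu'E.
exists nu' => rho; apply/idP/eqP => [/andP[/andP[strip _] /forallP inn]|->].
  have eq_sub : subdiagram la (extend0 rho) = subdiagram la nu.
    by apply/setP=> c; rewrite nu_mem (eqP (inn c)).
  have [_ rho_la] := strip_below strip.
  apply/ffunP=> i; apply: val_inj; rewrite /= -!extend0_ord nu'E.
  by apply/eqP; rewrite eqn_leq !subdiagram_leq ?eq_sub.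
apply/andP; split; last by apply/forallP=> c; rewrite sub_nu' nu_mem.
apply/andP; split.
  apply/forallP=> i; rewrite !nu'E nu_le /=; apply/implyP => i_gt0.
  (* Otherwise the cell [b] of row [i] in column [nu i.-1] lies in [mu]; the cell [a] above it then
     has an entry below [n] and yet lies outside [nu]. *)
  rewrite leqNgt; apply/negP => lt_i.
  have [_ mu_la] := mu_below.
  have [b [br bl]] := exists_cell (leq_trans lt_i (mu_la i)).
  have b_mu : b \in subdiagram la mu by rewrite in_subdiagram br bl.
  have [a [ar al]] : exists a, crow a = i.-1 /\ ccol a = nu i.-1.
    apply: exists_cell; apply: leq_trans lt_i _; apply: leq_trans (mu_la i) _.
    by apply: decreasing_leq la_dec (leq_pred i).
  have lt_ab : (T a < T b)%N by apply: T_col; rewrite ?al ?bl // ar br prednK.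
  have : a \in subdiagram la nu by rewrite nu_mem (leq_trans lt_ab) // -ltnS T_in.
  by rewrite in_subdiagram ar al ltnn.
rewrite -sum_extend0; under [X in _ == (X + _)%N]eq_bigr do rewrite nu'E.
rewrite -(card_subdiagram mu_below) // -(@card_subdiagram la nu) //.
have lt_n1 : (n < N.+1)%N by apply: ltnW.
rewrite -(T_cont (Ordinal lt_n1)) // -(cardsID (subdiagram la nu)) (setIidPr _); last first.
  by apply/subsetP=> c; rewrite nu_mem; exact: lt_in.
apply/eqP; congr (_ + _)%N; apply: eq_card => c; rewrite in_setD nu_mem !inE -leqNgt.
rewrite -val_eqE /= eqn_leq andbC; apply/andP/andP => [[c_mu le_n]|[le_Tn ->]].
  by rewrite -ltnS T_in ?in_subdiagram.
split=> //; apply: contraLR le_Tn; rewrite -in_subdiagram => /T_out->.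
by rewrite -ltnNge.
Qed.

(** Erases the entries [n]; [untruncate] restores them on the cells of [mu] outside [nu]. The two
    maps are inverse to each other on tableaux with inner shape [nu]. *)
Definition truncate T : {ffun cell la -> 'I_N.+1} :=
  [ffun c => if (T c < n)%N then T c else ord_max].

Definition untruncate (nu : nat -> nat) T : {ffun cell la -> 'I_N.+1} :=
  [ffun c => if c \in subdiagram la nu then T c else
             if c \in subdiagram la mu then inord n else ord_max].

Lemma card_inner (nu : {ffun 'I_n -> 'I_B}) : strip_of nu ->
  #|[set T | partial_tableau n.+1 mu T && inner T nu]| =
  #|[set T | partial_tableau n (extend0 nu) T]|.
Proof.
case/andP=> strip /eqP size_nu; have nu_below := strip_below strip.
have [nu_dec nu_la] := nu_below.
have n_val : (inord n : 'I_N.+1) = n :> nat by rewrite inordK // ltnW.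
have sub_nu c : c \in subdiagram la (extend0 nu) -> c \in subdiagram la mu.
  by rewrite !in_subdiagram => /leq_trans; apply; apply: strip_leq.
pose A := [set T | partial_tableau n.+1 mu T && inner T nu].
have trunK : {in A, cancel truncate (untruncate (extend0 nu))}.
  move=> T; rewrite inE => /andP[/partial_tableauP[T_in T_out _ _ _] /forallP inn].
  apply/ffunP=> c; rewrite !ffunE -(eqP (inn c)).
  have [//|le_n] := ltnP (T c) n; apply: val_inj.
  case: ifPn => [/T_in|/T_out/= ->//]; rewrite ltnS => le_T.
  by rewrite /= n_val; apply/eqP; rewrite eqn_leq le_n.
rewrite -/A -(card_in_imset (can_in_inj trunK)); apply: eq_card => T.
rewrite inE; apply/imsetP/idP => [[S S_A ->]|tabT].
  move: S_A; rewrite inE => /andP[/partial_tableauP[T_in T_out T_row T_col T_cont]].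
  move/forallP=> inn; apply/partial_tableauP; split.
  - by move=> c; rewrite ffunE -(eqP (inn c)) => lt_c; rewrite lt_c.
  - by move=> c; rewrite ffunE -(eqP (inn c)) => /negPf->.
  - move=> a b b_nu eq_r le_c; have := T_row a b (sub_nu b b_nu) eq_r le_c.
    move: b_nu; rewrite -(eqP (inn b)) !ffunE => lt_b le_ab.
    by rewrite lt_b (leq_ltn_trans le_ab).
  - move=> a b b_nu eq_c lt_r; have := T_col a b (sub_nu b b_nu) eq_c lt_r.
    move: b_nu; rewrite -(eqP (inn b)) !ffunE => lt_b lt_ab.
    by rewrite lt_b (ltn_trans lt_ab).
  - move=> k lt_k; rewrite -T_cont ?leqW //; apply: eq_card => c.
    rewrite !inE ffunE; have [//|le_n] := ltnP (S c) n; rewrite -!val_eqE /=.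
    by rewrite (gtn_eqF (ltn_trans lt_k lt_nN)) (gtn_eqF (leq_trans lt_k le_n)).
have [T_in T_out T_row T_col T_cont] := partial_tableauP _ _ _ tabT.
have U_nu c : c \in subdiagram la (extend0 nu) ->
    untruncate (extend0 nu) T c = T c by rewrite ffunE => ->.
have U_mu c : c \notin subdiagram la (extend0 nu) -> c \in subdiagram la mu ->
    untruncate (extend0 nu) T c = n :> nat by rewrite ffunE => /negPf-> ->.
have U_out c : c \notin subdiagram la mu -> untruncate (extend0 nu) T c = N :> nat.
  move=> c_mu; rewrite ffunE (negPf c_mu) ifN //.
  by apply: contra c_mu; apply: sub_nu.
have U_lt c : (untruncate (extend0 nu) T c < n)%N = (c \in subdiagram la (extend0 nu)).
  have [c_nu|c_nu] := boolP (c \in subdiagram la (extend0 nu)).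
    by rewrite U_nu // T_in.
  have [c_mu|c_mu] := boolP (c \in subdiagram la mu); first by rewrite U_mu // ltnn.
  by rewrite U_out // ltnNge ltnW.
exists (untruncate (extend0 nu) T); last first.
  apply/ffunP=> c; rewrite [in RHS]ffunE U_lt; case: ifPn => [/U_nu->//|/T_out c_N].
  exact: val_inj.
rewrite inE; apply/andP; split; last by apply/forallP=> c; rewrite U_lt.
apply/partial_tableauP; split=> //.
- move=> c c_mu; have [c_nu|c_nu] := boolP (c \in subdiagram la (extend0 nu)).
    by rewrite U_nu // ltnS ltnW // T_in.
  by rewrite U_mu.
- move=> a b b_mu eq_r le_c; have a_mu : a \in subdiagram la mu.
    by apply: subdiagram_ideal dec b_mu _ le_c; rewrite eq_r.
  have [b_nu|b_nu] := boolP (b \in subdiagram la (extend0 nu)).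
    have a_nu : a \in subdiagram la (extend0 nu).
      by apply: subdiagram_ideal nu_dec b_nu _ le_c; rewrite eq_r.
    by rewrite !U_nu // T_row.
  rewrite [leqRHS]U_mu //.
  have [a_nu|a_nu] := boolP (a \in subdiagram la (extend0 nu)); last by rewrite U_mu.
  by rewrite ltnW // U_lt.
- move=> a b b_mu eq_c lt_r.
  (* As [mu i.+1 <= nu i], a cell above a cell of [mu] belongs to the inner shape. *)
  have a_nu : a \in subdiagram la (extend0 nu).
    rewrite in_subdiagram eq_c; move: b_mu; rewrite in_subdiagram => /leq_trans; apply.
    apply: leq_trans (strip_geq (crow a) strip); exact: decreasing_leq.
  have [b_nu|b_nu] := boolP (b \in subdiagram la (extend0 nu)).
    by rewrite !U_nu // T_col.
  by rewrite [ltnRHS]U_mu // U_lt.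
- move=> k; rewrite ltnS leq_eqVlt => /predU1P[k_n|lt_k].
    have -> : [set c | untruncate (extend0 nu) T c == k] =
        subdiagram la mu :\: subdiagram la (extend0 nu).
      apply/setP=> c; rewrite in_setD inE -val_eqE /= k_n.
      have [c_nu|c_nu] /= := boolP (c \in subdiagram la (extend0 nu)).
        by rewrite ltn_eqF // U_lt.
      have [c_mu|c_mu] := boolP (c \in subdiagram la mu); first by rewrite U_mu ?eqxx.
      by rewrite U_out // gtn_eqF.
    rewrite cardsD (setIidPr _); last by apply/subsetP=> c; apply: sub_nu.
    rewrite (card_subdiagram (n := n.+1) mu_below) //.
    rewrite (card_subdiagram (n := n) nu_below) => [|i]; last exact: extend0_ge.
    by rewrite size_nu sum_extend0 addKn k_n.
  rewrite -T_cont //; apply: eq_card => c; rewrite !inE.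
  have [c_nu|c_nu] := boolP (c \in subdiagram la (extend0 nu)); first by rewrite U_nu.
  have le_n : (n <= untruncate (extend0 nu) T c)%N by rewrite leqNgt U_lt.
  by rewrite -!val_eqE /= (T_out _ c_nu) (gtn_eqF (ltn_trans lt_k lt_nN))
    (gtn_eqF (leq_trans lt_k le_n)).
Qed.

Lemma card_partial_tableau_rec :
  #|[set T | partial_tableau n.+1 mu T]| =
  (\sum_(nu : {ffun 'I_n -> 'I_B} | horizontal_strip n mu (extend0 nu) &&
       (\sum_(i < n.+1) mu i == \sum_i nu i + alpha n))
     #|[set T | partial_tableau n (extend0 nu) T]|)%N.
Proof.
rewrite -sum1dep_card.
transitivity (\sum_(T | partial_tableau n.+1 mu T) \sum_(rho | strip_of rho && inner T rho) 1)%N.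
  apply: eq_bigr => T /inner_unique[rho0 rho0P].
  by rewrite (big_pred1 rho0).
rewrite (exchange_big_dep strip_of) /=; last by move=> T nu _ /andP[].
apply: eq_bigr => nu strip; rewrite -card_inner // -sum1dep_card.
by apply: eq_bigl => T; rewrite strip.
Qed.
End Step.

(** The condition [mu 0 < B] passes to every inner shape, so sums over functions with values below
    [B] miss none of them. *)
Lemma card_partial_tableau n mu B : (n <= N)%N -> shape_below la mu ->
  (forall i, (n <= i)%N -> mu i = 0%N) -> (mu 0 < B)%N ->
  #|[set T | partial_tableau n mu T]| = kostka B n mu alpha.
Proof.
elim: n mu => [|n IHn] mu le_n mu_below mu0 muB.
  apply/eqP/cards1P; exists [ffun => ord_max]; apply/setP=> T; rewrite !inE.
  have out c : c \notin subdiagram la mu by rewrite in_subdiagram mu0.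
  apply/partial_tableauP/eqP => [[_ T_out _ _ _]|->].
    by apply/ffunP=> c; apply: val_inj; rewrite ffunE /= T_out.
  split=> // [c|c|a b|a b]; rewrite ?(negPf (out _)) // ffunE //.
rewrite (card_partial_tableau_rec (B := B)) //=; apply: eq_bigr => nu /andP[strip _].
apply: IHn; [exact: ltnW | exact: strip_below strip | | ].
  by move=> i; apply: extend0_ge.
exact: leq_ltn_trans (strip_leq 0 strip) muB.
Qed.
End PartialTableaux.

(** * Schur expansions *)

Lemma monomialE (D : finType) (f : {ffun D -> nat}) k :
  monomial f k = #|[set a | f a == k]|.
Proof.
rewrite mset_seqE count_map -sum1_count -sum1dep_card.
by rewrite big_enum_cond; apply: eq_bigl.
Qed.

(** As [m] vanishes from [n] on, maps with monomial [m] take values below [n]. The index set is thus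
    the image of a finite one, and [fset_set] counts it. *)
Lemma mono_sum_count (D : finType) (Q : {ffun D -> nat} -> Prop) n
    (q : pred {ffun D -> 'I_n}) (m : {mset nat}%mset) :
  (forall f : {ffun D -> 'I_n}, reflect (Q [ffun a => nat_of_ord (f a)]) (q f)) ->
  (forall k, (n <= k)%N -> m k = 0%N) ->
  mono_sum Q (@monomial D) m =
  #|[set f | q f & [forall k : 'I_n, #|[set a | f a == k]| == m k]]|%:Z.
Proof.
move=> qP m0; pose lift (f : {ffun D -> 'I_n}) := [ffun a => nat_of_ord (f a)].
have lift_inj : injective lift.
  move=> f g /ffunP eq_fg; apply/ffunP => a; apply: val_inj.
  by have := eq_fg a; rewrite !ffunE.
have monomial_lift f : monomial (lift f) = m <->
    forall k : 'I_n, #|[set a | f a == k]| = m k.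
  have countE (k : 'I_n) : monomial (lift f) k = #|[set a | f a == k]|.
    by rewrite monomialE; apply: eq_card => a; rewrite !in_set ffunE.
  split=> [<- k|count_f]; first by rewrite countE.
  apply/msetP => k; have [lt_k|le_k] := ltnP k n.
    by rewrite (countE (Ordinal lt_k)) count_f.
  rewrite m0 // monomialE; apply: eq_card0 => a; rewrite in_set ffunE.
  by rewrite ltn_eqF // (leq_trans (ltn_ord _)).
set A := [set f | _ & _].
rewrite /mono_sum; have -> : (fun f => Q f /\ monomial f = m) =
    classical_sets.mkset (fun f => f \in [fset lift f | f in A]%fset).
  apply: boolp.funext => f; apply: boolp.propext; split.
    case=> Qf mf; have lt_f a : (f a < n)%N.
      rewrite ltnNge; apply/negP => /m0; rewrite -mf monomialE => /eqP.
      by rewrite cards_eq0 => /eqP/setP/(_ a); rewrite !in_set eqxx.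
    have f_lift : f = lift [ffun a => Ordinal (lt_f a)].
      by apply/ffunP => a; rewrite !ffunE.
    apply/imfsetP; exists [ffun a => Ordinal (lt_f a)] => //=.
    rewrite in_set; apply/andP; split; first by apply/qP; rewrite -/(lift _) -f_lift.
    by apply/forallP => k; apply/eqP; apply/(monomial_lift _).1; rewrite -f_lift.
  case/imfsetP => g /=; rewrite in_set => /andP[/qP Qg /forallP count_g] ->; split=> //.
  by apply/monomial_lift => k; apply/eqP.
by rewrite cardinality.set_fsetK card_imfset //= -cardE.
Qed.

Lemma chromatic_sf_count (d : Order.disp_t) (P : finPOrderType d) n (m : {mset nat}%mset) :
  (forall k, (n <= k)%N -> m k = 0%N) ->
  chromatic_sf (@inc d P) m =
  #|chain_colorings (P := P) (fun k : 'I_n => m k)|%:Z.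
Proof.
move=> m0.
pose q (f : {ffun P -> 'I_n}) := [forall u, forall v, inc u v ==> (f u != f v)].
have qP (f : {ffun P -> 'I_n}) :
    reflect (proper_coloring (@inc d P) [ffun a => nat_of_ord (f a)]) (q f).
  apply: (iffP forallP) => [qf u v inc_uv|proper u].
    have /forallP/(_ v)/implyP/(_ inc_uv) := qf u.
    by rewrite !ffunE => /eqP neq /val_inj.
  apply/forallP => v; apply/implyP => /proper neq; apply/eqP => eq_f.
  by apply: neq; rewrite !ffunE eq_f.
rewrite /chromatic_sf (mono_sum_count qP m0); congr (_%:Z); apply: eq_card => f.
rewrite !in_set; apply/andP/forallP => [[/forallP qf /forallP count_f] k|chain_f].
  rewrite count_f andbT; apply/forall_inP => u; rewrite in_set => /eqP fu.
  apply/forall_inP => v; rewrite in_set => /eqP fv.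
  by have /forallP/(_ v) := qf u; rewrite fu fv eqxx implybF /inc /= negbK.
split; last by apply/forallP => k; have /andP[] := chain_f k.
apply/forallP => u; apply/forallP => v; apply/implyP => inc_uv; apply/eqP => eq_f.
have /andP[/forall_inP chain_u _] := chain_f (f u).
have /forall_inP/(_ v) : [forall b in [set w | f w == f u], (u >=< b)%O].
  by apply: chain_u; rewrite in_set.
by rewrite in_set eq_f eqxx => /(_ isT); move: inc_uv; rewrite /inc /= => /negPf->.
Qed.

(** The partial tableaux of full shape have entries in ['I_N.+1]; the value [N], reserved for cells
    outside the shape, does not occur because [m N = 0]. *)
Lemma schur_count la N B (m : {mset nat}%mset) : is_part la -> (size la <= N)%N ->
  (forall k, (N <= k)%N -> m k = 0%N) -> (nth 0%N la 0 < B)%N ->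
  schur la m = (kostka B N (nth 0%N la) m)%:Z.
Proof.
move=> la_part le_la m0 ltB; have la_dec := is_part_decreasing la_part.
have la_below : shape_below la (nth 0%N la) by [].
have in_la c : c \in subdiagram la (nth 0%N la) by rewrite in_subdiagram ccol_lt.
rewrite -(@card_partial_tableau la m N la_dec N (nth 0%N la) B) //; last first.
  by move=> i le_i; rewrite nth_default // (leq_trans le_la).
pose q (T : {ffun cell la -> 'I_N.+1}) :=
  [forall a, forall b, ((crow a == crow b) && (ccol a <= ccol b)%N ==> (T a <= T b)%N) &&
        ((ccol a == ccol b) && (crow a < crow b)%N ==> (T a < T b)%N)].
have qP (T : {ffun cell la -> 'I_N.+1}) : reflect (semistandard [ffun c => nat_of_ord (T c)]) (q T).
  apply: (iffP forallP) => [qT|[row_T col_T] a].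
    split=> a b; have /forallP/(_ b)/andP[/implyP row_T /implyP col_T] := qT a.
      by move=> eq_r le_c; rewrite !ffunE; apply: row_T; rewrite eq_r eqxx.
    by move=> eq_c lt_r; rewrite !ffunE; apply: col_T; rewrite eq_c eqxx.
  apply/forallP => b; apply/andP; split; apply/implyP => /andP[/eqP eq_ab le_ab].
    by have := row_T a b eq_ab le_ab; rewrite !ffunE.
  by have := col_T a b eq_ab le_ab; rewrite !ffunE.
rewrite /schur (mono_sum_count qP); last by move=> k /ltnW /m0.
congr (_%:Z); apply: eq_card => T; rewrite !in_set.
apply/andP/partial_tableauP => [[/forallP qT /forallP count_T]|[T_lt _ row_T col_T count_T]].
  split=> [c _|c|a b _ eq_r le_c|a b _ eq_c lt_r|k _].
  - rewrite ltn_neqAle -ltnS ltn_ord andbT; apply/eqP => Tc.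
    have := count_T (T c); rewrite Tc m0 // cards_eq0 => /eqP/setP/(_ c).
    by rewrite !in_set eqxx.
  - by rewrite in_la.
  - have /forallP/(_ b)/andP[/implyP H _] := qT a.
    by apply: H; rewrite eq_r eqxx.
  - have /forallP/(_ b)/andP[_ /implyP H] := qT a.
    by apply: H; rewrite eq_c eqxx.
  - exact/eqP/count_T.
split.
  apply/forallP => a; apply/forallP => b; apply/andP.
  by split; apply/implyP => /andP[/eqP eq_ab]; [apply: row_T | apply: col_T].
apply/forallP => k; have [lt_k|le_k] := ltnP k N; first by rewrite count_T.
rewrite m0 // cards_eq0; apply/eqP/setP => c; rewrite !in_set -val_eqE /=.
by rewrite ltn_eqF // (leq_trans (T_lt c _)).
Qed.

Lemma intpart_nth_inj (la mu : intpart) :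
  (forall i, nth 0%N la i = nth 0%N mu i) -> la = mu.
Proof.
have le_size (nu rho : intpart) : (forall i, nth 0%N nu i = nth 0%N rho i) ->
    (size nu <= size rho)%N.
  move=> eq_nr; rewrite leqNgt; apply/negP => /(is_part_gt0 (valP nu)).
  by rewrite eq_nr nth_default.
move=> eq_lm; apply: val_inj; apply: (@eq_from_nth _ 0%N) => //.
by apply/eqP; rewrite eqn_leq !le_size.
Qed.

(** * Linear independence of the Schur functions *)

Section Uniqueness.
Implicit Types la mu : intpart.

(** The superstandard tableau, whose content is [la] itself. *)
Definition row_filling (la : seq nat) : {ffun cell la -> nat} := [ffun c => crow c].

(** The statistic usually written n(lambda); it replaces the dominance order as the measure for
    triangularity. *)
Definition row_sum (la : seq nat) : nat := (\sum_(c : cell la) crow c)%N.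

Lemma sum_monomial (D1 D2 : finType) (f : {ffun D1 -> nat}) (g : {ffun D2 -> nat}) :
  monomial f = monomial g -> (\sum_a f a = \sum_a g a)%N.
Proof.
move/eq_seq_msetP => eq_fg.
rewrite -big_enum -[RHS]big_enum /= -(big_map f predT id) -(big_map g predT id).
exact: perm_big.
Qed.

Lemma semistandard_crow la (T : {ffun cell la -> nat}) c :
  semistandard T -> (crow c <= T c)%N.
Proof.
case=> _ col_T; have [k] := ubnP (crow c); elim: k c => // k IHk c le_k.
case E: (crow c) => [//|i].
have [a [ai al]] : exists a : cell la, crow a = i /\ ccol a = ccol c.
  apply: exists_cell; apply: leq_trans (ccol_lt c) _; rewrite E.
  exact/is_part_decreasing/(valP la).
have lt_ac : (crow a < crow c)%N by rewrite ai E.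
rewrite -ai; apply: leq_ltn_trans (IHk a _) (col_T a c al lt_ac).
exact: leq_trans lt_ac _.
Qed.

Lemma row_filling_semistandard la : semistandard (row_filling la).
Proof. by split=> a b; rewrite !ffunE // => ->. Qed.

(** The sum of the entries depends only on the monomial, and each entry is at least its row index;
    equality of the sums makes every entry minimal. *)
Lemma row_sum_leq la mu (T : {ffun cell mu -> nat}) : semistandard T ->
  monomial T = monomial (row_filling la) ->
  (row_sum mu <= row_sum la)%N /\ (row_sum mu = row_sum la -> T = row_filling mu).
Proof.
move=> ss_T /sum_monomial; have -> : (\sum_a row_filling la a)%N = row_sum la.
  by apply: eq_bigr => c _; rewrite ffunE.
move=> <-; split=> [|eq_sum]; first by apply: leq_sum => c _; apply: semistandard_crow.
apply/ffunP => c; rewrite ffunE; apply/esym/eqP.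
have [_ eq_all] : (\sum_(b : cell mu) crow b <= \sum_b T b ?= iff [forall b, crow b == T b])%N.
  by apply: leqif_sum => b _; split=> //; apply: semistandard_crow.
by have /forallP/(_ c) : [forall b, crow b == T b] by rewrite -eq_all -/(row_sum mu) eq_sum.
Qed.

Lemma row_filling_inj la mu :
  monomial (row_filling la) = monomial (row_filling mu) -> la = mu.
Proof.
have count_row (nu : intpart) i : monomial (row_filling nu) i = nth 0%N nu i.
  rewrite monomialE; have [lt_i|le_i] := ltnP i (size nu).
    rewrite -(row_len_subdiagram (la := nu) (mu := nth 0%N nu) (i := Ordinal lt_i)) //.
    by apply: eq_card => c; rewrite !in_set ffunE ccol_lt -val_eqE.
  rewrite nth_default //; apply: eq_card0 => c; rewrite in_set ffunE.
  by rewrite ltn_eqF // (leq_trans (ltn_ord _)).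
by move=> eq_m; apply: intpart_nth_inj => i; rewrite -!count_row eq_m.
Qed.

Lemma schur_row_filling la : schur la (monomial (row_filling la)) = 1.
Proof.
rewrite /schur /mono_sum; have -> : (fun T : {ffun cell la -> nat} => semistandard T /\
    monomial T = monomial (row_filling la)) = classical_sets.set1 (row_filling la).
  apply: boolp.funext => T; apply: boolp.propext; split=> [[ss_T /(row_sum_leq ss_T)[_]]|->].
    exact.
  by split=> //; apply: row_filling_semistandard.
by rewrite cardinality.fset_set1 cardfs1.
Qed.

Lemma schur_neq0 la m : schur la m != 0 ->
  exists2 T : {ffun cell la -> nat}, semistandard T & monomial T = m.
Proof.
move=> neq0; case: (boolp.pselect (exists T : {ffun cell la -> nat},
    semistandard T /\ monomial T = m)) => [[T [ss_T Tm]]|no]; first by exists T.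
case/eqP: neq0; rewrite /schur /mono_sum.
have -> : (fun T : {ffun cell la -> nat} => semistandard T /\ monomial T = m) =
    classical_sets.set0.
  by apply: boolp.funext => T; apply: boolp.propext; split=> // ssT; case: no; exists T.
by rewrite cardinality.fset_set0 cardfs0.
Qed.

(* At the monomial of [row_filling la], only [schur la] and the [schur mu] with
   [row_sum mu < row_sum la] do not vanish: the Schur functions are triangular. *)
Lemma schur_expansion_unique f (c1 c2 : {fsfun intpart -> int with 0}) :
  schur_expansion f c1 -> schur_expansion f c2 -> c1 =1 c2.
Proof.
move=> exp1 exp2 la; have [k] := ubnP (row_sum la); elim: k la => // k IHk la le_k.
pose m := monomial (row_filling la).
pose S := (finsupp c1 `|` finsupp c2 `|` [fset la])%fset.
have expS (c : {fsfun intpart -> int with 0}) : schur_expansion f c ->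
    (finsupp c `<=` S)%fset -> f m = \sum_(mu <- S) c mu * schur mu m.
  move=> -> sub; apply: big_fset_incl => // mu _; rewrite memNfinsupp => /eqP->.
  by rewrite mul0r.
have : \sum_(mu <- S) c1 mu * schur mu m = \sum_(mu <- S) c2 mu * schur mu m.
  rewrite -!expS //; apply/fsubsetP => mu; rewrite !in_fsetE => ->; rewrite ?orbT //.
rewrite (big_fsetD1 la) /= ?[RHS](big_fsetD1 la) /=; try by rewrite !in_fsetE eqxx !orbT.
rewrite schur_row_filling !mulr1.
suff -> : \sum_(mu <- (S `\ la)%fset) c1 mu * schur mu m =
    \sum_(mu <- (S `\ la)%fset) c2 mu * schur mu m by apply: addIr.
apply: eq_big_seq => mu; rewrite in_fsetE => /andP[neq_mu _].
have [->|/schur_neq0[T ss_T Tm]] := eqVneq (schur mu m) 0; first by rewrite !mulr0.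
have [le_mu eq_mu] := row_sum_leq ss_T Tm; rewrite IHk //.
apply: leq_trans (le_k : (_ <= k)%N); rewrite ltn_neqAle le_mu andbT.
apply: contra neq_mu => /eqP/eq_mu eqT; rewrite in_fsetE; apply/eqP/row_filling_inj.
by rewrite -eqT Tm.
Qed.
End Uniqueness.

(** * Partitions as bounded weakly decreasing functions *)

Lemma nth_filter_gt0 s i : sorted geq s ->
  nth 0%N [seq x <- s | 0 < x]%N i = nth 0%N s i.
Proof.
elim: s i => //= x s IHs i sorted_xs; case: (posnP x) => [x0|x_gt0]; last first.
  by case: i => //= i; apply/IHs/(path_sorted sorted_xs).
have /allP s0 : all (geq x) s.
  by apply: order_path_min sorted_xs => a b c /= ba cb; apply: leq_trans cb ba.
have -> : [seq y <- s | 0 < y]%N = [::].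
  rewrite -(filter_pred0 s); apply: eq_in_filter => y /s0 /=.
  by rewrite x0 leqn0 => /eqP->.
rewrite nth_nil; case: i => //= i; have [lt_i|le_i] := ltnP i (size s).
  by have := s0 _ (mem_nth 0%N lt_i); rewrite /= x0 leqn0 => /eqP->.
by rewrite nth_default.
Qed.

Definition nil_part : intpart := IntPart (isT : is_part [::]).

Lemma nth_leq_sumn (s : seq nat) i : (nth 0 s i <= sumn s)%N.
Proof.
elim: s i => [|x s IHs] [|i] //=; first exact: leq_addr.
exact: leq_trans (IHs i) (leq_addl _ _).
Qed.

Lemma size_leq_sumn (la : intpart) : (size la <= sumn la)%N.
Proof.
case: la => s /= /andP[_]; elim: s => //= x s IHs; rewrite inE negb_or.
by case/andP=> x0 /IHs; rewrite -add1n; apply: leq_add; rewrite lt0n eq_sym.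
Qed.

Section PartOf.
Variables (N B : nat).
Implicit Types (nu : {ffun 'I_N -> 'I_B}).

(** The zeros of a weakly decreasing function are at its end, so dropping them moves no part. On
    other functions the value may be the default [nil_part]. *)
Definition part_of nu : intpart :=
  insubd nil_part [seq x <- [seq extend0 nu i | i <- iota 0 N] | 0 < x]%N.

Definition decreasingb nu := [forall i : 'I_N, extend0 nu i.+1 <= extend0 nu i]%N.

Lemma decreasingP nu : reflect (decreasing (extend0 nu)) (decreasingb nu).
Proof.
apply: (iffP forallP) => [dec i|dec i]; last exact: dec.
have [le_Ni|lt_iN] := leqP N i; first by rewrite extend0_ge // leqW.
exact: dec (Ordinal lt_iN).
Qed.

Lemma sorted_extend0 nu : decreasingb nu -> sorted geq [seq extend0 nu i | i <- iota 0 N].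
Proof.
move/decreasingP=> dec; apply/(sortedP 0%N) => i; rewrite size_map size_iota => lt_i.
by rewrite !(nth_map 0%N) ?size_iota ?nth_iota ?(ltnW lt_i) // add0n; apply: dec.
Qed.

Lemma part_ofE nu : decreasingb nu ->
  part_of nu = [seq x <- [seq extend0 nu i | i <- iota 0 N] | 0 < x]%N :> seq nat.
Proof.
move=> dec; rewrite /part_of val_insubd ifT // /is_part mem_filter ltnn andbT.
apply: sorted_filter (sorted_extend0 dec) => a b c /= ba cb; exact: leq_trans cb ba.
Qed.

Lemma nth_part_of nu i : decreasingb nu -> nth 0%N (part_of nu) i = extend0 nu i.
Proof.
move=> dec; rewrite part_ofE // nth_filter_gt0 ?sorted_extend0 //.
have [le_Ni|lt_iN] := leqP N i.
  by rewrite nth_default ?size_map ?size_iota // extend0_ge.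
by rewrite (nth_map 0%N) ?size_iota // nth_iota.
Qed.

Lemma size_part_of nu : decreasingb nu -> (size (part_of nu) <= N)%N.
Proof.
move=> dec; rewrite part_ofE // size_filter.
by apply: leq_trans (count_size _ _) _; rewrite size_map size_iota.
Qed.

Lemma sumn_part_of nu : decreasingb nu -> sumn (part_of nu) = (\sum_(i < N) extend0 nu i)%N.
Proof.
move=> dec; rewrite part_ofE // sumnE big_filter big_map big_mkcond.
have -> : iota 0 N = index_iota 0 N by rewrite /index_iota subn0.
by rewrite big_mkord; apply: eq_bigr => i _; case: posnP.
Qed.

Lemma part_of_inj : {in decreasingb &, injective part_of}.
Proof.
move=> nu rho dec_nu dec_rho eq_nr; apply/ffunP => i; apply: val_inj => /=.
by rewrite -!extend0_ord -!nth_part_of // eq_nr.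
Qed.

Lemma part_of_onto (la : intpart) : (size la <= N)%N -> (nth 0%N la 0 < B)%N ->
  exists2 nu, decreasingb nu & la = part_of nu.
Proof.
move=> le_la ltB; have la_dec := is_part_decreasing (valP la).
have la_B i : (nth 0%N la i < B)%N.
  by apply: leq_ltn_trans ltB; apply: (decreasing_leq la_dec).
pose nu : {ffun 'I_N -> 'I_B} := [ffun i : 'I_N => Ordinal (la_B i)].
have nuE i : extend0 nu i = nth 0%N la i.
  have [le_Ni|lt_iN] := leqP N i.
    by rewrite extend0_ge // nth_default // (leq_trans le_la).
  by rewrite -[i]/(nat_of_ord (Ordinal lt_iN)) extend0_ord ffunE.
have dec : decreasingb nu by apply/decreasingP => i; rewrite !nuE; apply: la_dec.
by exists nu => //; apply: intpart_nth_inj => i; rewrite nth_part_of.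
Qed.
End PartOf.

(** * The Schur expansion of the chromatic symmetric function *)

Section Expansion.
Variables (d : Order.disp_t) (P : finPOrderType d).

Definition chain_coef (la : seq nat) : int :=
  full_coef (jacobi_trudi (chain_sum P) (size la) (nth 0%N la)).

(** A partition of [#|P|] has at most [#|P|] rows, each of length at most [#|P|], so the finite set
    given here contains all of them; the test on the size discards the others. *)
Definition chain_coefs : {fsfun intpart -> int with 0} :=
  [fsfun la in [fset part_of nu | nu in {: {ffun 'I_#|P| -> 'I_#|P|.+1}}]%fset =>
     if sumn (la : intpart) == #|P| then chain_coef la else 0].

Lemma chain_coefsE (la : intpart) :
  chain_coefs la = if sumn la == #|P| then chain_coef la else 0.
Proof.
rewrite fsfunE; case: ifPn => // notin; case: eqP => // la_P; case/negP: notin.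
have [||nu _ ->] := @part_of_onto #|P| #|P|.+1 la.
- by rewrite -la_P size_leq_sumn.
- by rewrite ltnS -la_P nth_leq_sumn.
by apply/imfsetP; exists nu.
Qed.

Lemma mset_bound (m : {mset nat}%mset) : exists N, forall k, (N <= k)%N -> m k = 0%N.
Proof.
exists (\max_(i <- finsupp m) i).+1 => k lt_k; apply/eqP; rewrite -memNfinsupp.
apply: contraL lt_k => k_m; rewrite -leqNgt.
exact: (leq_bigmax_seq (F := id)).
Qed.

Lemma chromatic_sf_expansion : schur_expansion (chromatic_sf (@inc d P)) chain_coefs.
Proof.
move=> m; have [N0 m0'] := mset_bound m; set n := #|P|.
(* [N] bounds both the variables in [m] and the number of rows of a partition of [n]; [B] exceeds
   [n + N], for the Pieri rule, and every exponent of [m]. *)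
pose N := (n + N0)%N; pose B := (n + N + \sum_(k < N) m k).+1%N.
have m0 k : (N <= k)%N -> m k = 0%N.
  by move=> le_k; apply: m0'; apply: leq_trans le_k; apply: leq_addl.
have leB : (n + N < B)%N by rewrite ltnS leq_addr.
have mB k : (k < N)%N -> (m k < B)%N.
  move=> lt_k; rewrite ltnS (bigD1 (Ordinal lt_k)) //= addnCA leq_addr //.
have supp_sub : (finsupp chain_coefs `<=`
    [fset part_of nu | nu in [pred nu : {ffun 'I_N -> 'I_B} | decreasingb nu]])%fset.
  apply/fsubsetP => la; rewrite mem_finsupp chain_coefsE.
  have [la_n _|_] := eqVneq (sumn la) #|P|; last by rewrite eqxx.
  have [||nu dec ->] := @part_of_onto N B la.
  - by rewrite (leq_trans (size_leq_sumn la)) // la_n leq_addr.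
  - apply: leq_ltn_trans (nth_leq_sumn _ _) _; rewrite la_n; apply: leq_ltn_trans leB.
    exact: leq_addr.
  by apply/imfsetP; exists nu.
rewrite (big_fset_incl _ supp_sub) => [|la _]; last first.
  by rewrite memNfinsupp => /eqP->; rewrite mul0r.
rewrite big_imfset /=; last by move=> nu rho; apply: part_of_inj.
have schurE (nu : {ffun 'I_N -> 'I_B}) : decreasingb nu ->
    schur (part_of nu) m = (kostka B N (extend0 nu) m)%:Z.
  move=> dec; rewrite (@schur_count _ N B) ?size_part_of ?nth_part_of ?extend0_lt //; last first.
    exact: valP.
  by congr (_%:Z); apply: eq_kostka => i; rewrite nth_part_of.
have kostka_sum (nu : {ffun 'I_N -> 'I_B}) : kostka B N (extend0 nu) m != 0%N ->
    (\sum_(i < N) extend0 nu i = \sum_(k < N) m k)%N.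
  by apply: kostka_size => i; apply: extend0_ge.
rewrite (chromatic_sf_count P m0).
(* If the degree of [m] is not [n], both sides vanish: a coloring has [n] factors, and a nonzero
   Kostka number forces the shape to have the degree of [m] as its size. *)
have [sum_m|sum_m] := eqVneq (\sum_(k < N) m k)%N n; last first.
  rewrite (_ : chain_colorings _ = finset.set0) ?cards0.
    rewrite big1_seq // => nu /andP[_]; rewrite mem_enum => dec.
    rewrite chain_coefsE sumn_part_of // schurE //.
    have [->|/kostka_sum->] := eqVneq (kostka B N (extend0 nu) m) 0%N; first by rewrite mulr0.
    by rewrite (negPf sum_m) mul0r.
  apply/setP => f; rewrite in_set in_set0; apply: contraNF sum_m => /forallP count_f.
  rewrite /n -sum1_card (partition_big f predT) //=; apply/eqP/eq_bigr => k _.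
  by have /andP[_ /eqP<-] := count_f k; rewrite sum1dep_card.
rewrite -natz -full_coef_prod_chain_sum.
rewrite (prod_kostka (@chain_sum_large d P) leB mB) /full_coef raddf_sum /=.
rewrite big_enum_cond /= [RHS](eq_bigl (@decreasingb N B)); last by move=> nu; apply: andbT.
rewrite [RHS]big_mkcond; apply: eq_bigr => nu _; rewrite raddfMn /=.
(* A function that is not weakly decreasing has Kostka number 0, so the sum over all [nu] is a sum
   over partitions. *)
have [K0|K_neq0] := eqVneq (kostka B N (extend0 nu) m) 0%N.
  by rewrite K0 mulr0n; case: ifP => // dec; rewrite schurE // K0 mulr0.
have dec : decreasingb nu.
  by apply/decreasingP; apply: kostka_neq0_decr K_neq0 => i; apply: extend0_ge.
rewrite dec schurE // chain_coefsE sumn_part_of // kostka_sum // sum_m eqxx.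
have jtE : jacobi_trudi (chain_sum P) (size (part_of nu)) (nth 0%N (part_of nu)) =
    jacobi_trudi (chain_sum P) N (extend0 nu).
  transitivity (jacobi_trudi (chain_sum P) N (nth 0%N (part_of nu))).
    apply/esym/jacobi_trudi_widen; first exact: chain_sum0.
      exact: size_part_of.
    by move=> i; apply: nth_default.
  by apply: eq_jacobi_trudi => i _; apply: nth_part_of.
by rewrite -mulr_natr natz /chain_coef /full_coef jtE.
Qed.
End Expansion.

Theorem theorem4p11 (d : Order.disp_t) (P : finPOrderType d) (la : intpart)
    (hla : sumn la = #|P|) :
  schur_coef (chromatic_sf (@inc d P)) la =
  \sum_(T in tail_g_tabloids P la) g_tabloid_sign T.
Proof.
rewrite sum_tail_g_tabloids_jacobi_trudi ?(valP la) // -/(chain_coef P la).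
rewrite /schur_coef; set c := classical_sets.xget _ _.
(* [xget] yields an expansion because one exists; uniqueness then identifies it with
   [chain_coefs]. *)
have exp_c : schur_expansion (chromatic_sf (@inc d P)) c.
  by apply: classical_sets.xgetPex; exists (chain_coefs P); apply: chromatic_sf_expansion.
rewrite (schur_expansion_unique exp_c (chromatic_sf_expansion P)).
by rewrite chain_coefsE hla eqxx.
Qed.
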